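(* Let $l\ge 3$ be a prime and let $q=p^{r}\equiv 1 \pmod{2l^{2}}$ be a prime power. Fix a generator $\gamma$ of $\mathbb{F}_q^*$ and let $w=\mathrm{ind}_\gamma 2$. Write $\zeta_{l^2}=\exp(2\pi i/l^2)$, and let $\chi=\chi_{2l^2}$, the Jacobi sums $J_{2l^2}(i,j)$ and the integers $c_{i,m}$ be as defined in the context. All congruences are in $\mathbb{Z}[\zeta_{l^2}]=\mathbb{Z}[\zeta_{2l^2}]$ modulo the ideal generated by $(1-\zeta_{l^2})^{l+1}$. Let $n$ be an odd integer with $1\le n\le 2l^2-1$. (1) If $n=l^2$, then $$J_{2l^2}(1,n)\equiv \zeta_{l^2}^{-w}\Bigl(-1+\sum_{i=3}^{l}c_{i,(l^2-1)/2}(\zeta_{l^2}-1)^i\Bigr)\pmod{(1-\zeta_{l^2})^{l+1}}.$$ (2) If $n=dl$ with $d$ an odd integer, $1\le d\le 2l-1$, $d\ne l$, then $$J_{2l^2}(1,n)\equiv -\zeta_{l^2}^{-w(dl+1)}\Bigl(-1+\sum_{i=3}^{l}c_{i,(l^2-1)/2}(\zeta_{l^2}-1)^i\Bigr)\Bigl(-1+\sum_{i=3}^{l}c_{i,dl-1}\bigl(\zeta_{l^2}^{(-1-dl)/2}-1\bigr)^i\Bigr)\pmod{(1-\zeta_{l^2})^{l+1}}.$$ (3) If $\gcd(n,2l^2)=1$ and $1\le n<2l^2-1$, then $$J_{2l^2}(1,n)\equiv \zeta_{l^2}^{-w(n+1)}\Bigl(-1+\sum_{i=3}^{l}c_{i,(l^2-1)/2}(\zeta_{l^2}-1)^i\Bigr)\Bigl(-1+\sum_{i=3}^{l}c_{i,(l^2-1)/2}(\zeta_{l^2}^{n}-1)^i\Bigr)\Bigl(-1+\sum_{i=3}^{l}c_{i,-1-n}\bigl(\zeta_{l^2}^{(1-l^2)/2}-1\bigr)^i\Bigr)\pmod{(1-\zeta_{l^2})^{l+1}}.$$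 (4) If $n=2l^2-1$, then $J_{2l^2}(1,n)\equiv -1\pmod{(1-\zeta_{l^2})^{l+1}}$. Moreover, if $n$ is an even integer with $2\le n\le 2l^2-2$, then $J_{2l^2}(1,n)=\chi(-1)\,J_{2l^2}(1,2l^2-n-1)$, where $2l^2-n-1$ is odd (so that the congruences above determine $J_{2l^2}(1,n)$ modulo $(1-\zeta_{l^2})^{l+1}$).
   Context: For an integer $e\ge 2$ with $q\equiv 1\pmod e$, put $\zeta_e=\exp(2\pi i/e)$ and let $\chi_e$ be the multiplicative character of $\mathbb{F}_q^*$ with $\chi_e(\gamma)=\zeta_e$ (the same fixed generator $\gamma$ is used for all $e$). For every integer $i$, $\chi_e^i$ is extended to $\mathbb{F}_q$ by $\chi_e^i(0)=0$ (also for $i\equiv 0 \pmod e$). The Jacobi sum of order $e$ is $$J_e(i,j)=\sum_{v\in\mathbb{F}_q}\chi_e^i(v)\,\chi_e^j(v+1),$$ with $i,j$ read modulo $e$. One has $\zeta_{l^2}=\zeta_{2l^2}^2$ and $\chi_{l^2}=\chi_{2l^2}^2$. For $x\in\mathbb{F}_q^*$, $\mathrm{ind}_\gamma x$ is the integer $a\in\{0,\dots,q-2\}$ with $\gamma^a=x$. Here $\mathrm{ind}_\gamma 2$ means the index of the element $2\in\mathbb{F}_q^*$. The coefficients $c_{i,m}$ ($m\in\mathbb{Z}$, $3\le i\le l$) are defined as follows. For $v\in\mathbb{F}_q\setminus\{0,-1\}$ put $N_m(v)=\mathrm{ind}_\gamma v+m\,\mathrm{ind}_\gamma(v+1)$.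 For $0\le s\le l-1$ let $b_{s,m}$ be the number of $v\in\mathbb{F}_q\setminus\{0,-1\}$ with $N_m(v)\equiv s\pmod l$; thus $J_l(1,m)=\sum_{s=0}^{l-1}b_{s,m}\zeta_l^s$. Then $$c_{i,m}=\sum_{s=i}^{l-1}\binom{s}{i}b_{s,m}\quad(3\le i\le l-1),\qquad c_{l,m}=S(m)=\sum_{v\in\mathbb{F}_q\setminus\{0,-1\}}\Bigl\lfloor\frac{N_m(v)}{l}\Bigr\rfloor .$$ Only the residues of the $c_{i,m}$ modulo $l$ matter for congruences modulo $(1-\zeta_{l^2})^{l+1}$, and these residues depend only on $m$ modulo $l^2$. They are the coefficients occurring in the expansion $J_{l^2}(1,m)\equiv -1+\sum_{i=3}^{l}c_{i,m}(\zeta_{l^2}-1)^i\pmod{(1-\zeta_{l^2})^{l+1}}$ of the Jacobi sums of order $l^2$. *)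

(* Defs.v *)
From HB Require Import structures.
From mathcomp Require Import all_boot all_order all_algebra all_fingroup cyclic.
From mathcomp Require Import complex reals trigo.

Set Implicit Arguments.
Unset Strict Implicit.
Unset Printing Implicit Defensive.

Import Order.TTheory GRing.Theory Num.Theory.
Local Open Scope ring_scope.

Section RootsOfUnity.
Variable R : realType.

(* exp(2 i pi / e), written with cosine and sine since the library has no
   complex exponential. *)
Definition zeta (e : nat) : R[i] :=
  Complex (cos (2 * pi / e%:R)) (sin (2 * pi / e%:R)).

(* Membership in Z[z], the image of evaluation at z of integer polynomials. *)
Definition in_Zadj (z x : R[i]) : Prop :=
  exists P : {poly int}, x = (map_poly intr P).[z].

(* Congruence in the ring Z[z] modulo the principal ideal of Z[z] generated
   by u; both sides are required to lie in Z[z]. *)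
Definition congr_Zadj (z u a b : R[i]) : Prop :=
  [/\ in_Zadj z a, in_Zadj z b
    & exists2 y, in_Zadj z y & a - b = u * y].

End RootsOfUnity.

Section JacobiSums.
Variables (R : realType) (F : finFieldType) (g : {unit F}).

(* The discrete logarithm to base g, a number in 0 .. #|F| - 2 when g generates
   the unit group and x != 0; junk value #|F| - 1 at x = 0. *)
Definition ind (x : F) : nat :=
  index x (mkseq (fun a => FinRing.uval g ^+ a) #|F|.-1).

(* chi_e ^ i, where chi_e is the multiplicative character of order e with
   chi_e g = zeta e. Its value at 0 is 0 even when e divides i. *)
Definition chi (e : nat) (i : int) (v : F) : R[i] :=
  if v == 0 then 0 else (zeta R e ^+ ind v) ^ i.

(* Jacobi sum of order e; the second argument is v + 1, not 1 - v. *)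
Definition jacobi (e : nat) (i j : int) : R[i] :=
  \sum_(v : F) chi e i v * chi e j (v + 1).

End JacobiSums.

Section Coefficients.
Variables (R : realType) (F : finFieldType) (g : {unit F}) (l : nat).

Definition Nind (m : int) (v : F) : int :=
  (ind g v)%:Z + m * (ind g (v + 1))%:Z.

Definition bcoef (s : nat) (m : int) : nat :=
  #|[set v : F | [&& v != 0, v != -1
                   & (Nind m v == s%:Z %[mod l%:Z])%Z]]|.

(* For l > 0, (_ %/ l)%Z is the floor of the quotient, also for negative
   dividends. *)
Definition Ssum (m : int) : int :=
  \sum_(v : F | (v != 0) && (v != -1)) (Nind m v %/ l%:Z)%Z.

(* Meaningful for 3 <= i <= l only. *)
Definition ccoef (i : nat) (m : int) : int :=
  if i == l then Ssum m
  else \sum_(i <= s < l) ('C(s, i) * bcoef s m)%N%:Z.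

(* -1 + \sum_(i = 3 .. l) c_(i,m) (x - 1) ^ i *)
Definition cexpansion (m : int) (x : R[i]) : R[i] :=
  -1 + \sum_(3 <= i < l.+1) (ccoef i m)%:~R * (x - 1) ^+ i.

End Coefficients.

(* Main.v *)
(** Put z = zeta_{l^2}, y = zeta_{2 l^2} and eta = -y, so that eta^2 = z, eta has
    order l^2 and, for odd n, y^n = - eta^n.

    Writing J(u, v) for the Jacobi sum of the characters with values u and v at
    the generator, the associativity and norm relations of Jacobi sums and the
    duplication formula u(4) J(u, u) = J(u, -1) give, for odd n not divisible by
    l^2, the exact identity
      J(eta^2, eta^-1) J(eta^2n, eta^-n) J(eta, eta^-(n+1)) = q z^(w(n+1)) J(y, y^n),
    and J(eta^2, eta^-1) = z^w J(y, -1) when n = l^2; here q = 1 modulo l^2.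

    Each factor on the left has order dividing l^2, hence the form
    sum_v x^N(v) with x a power of z. As (1 - z)^(l+1) divides l, writing
    N = s + k l gives x^N = x^s + k (x - 1)^l modulo (1 - z)^(l+1). Expanding x^s
    in powers of x - 1, the coefficients of degree 1 and 2 vanish modulo l since
    the index a(v) satisfies sum a(v) = sum a(v)^2 = sum a(v) a(v+1) = 0 modulo l,
    the last sum being turned into its opposite by v -> 1/v. *)

Require Import Defs.
From HB Require Import structures.
From mathcomp Require Import all_boot all_order all_algebra all_fingroup cyclic finfield.
From mathcomp Require Import complex reals trigo ring lra zify.

Set Implicit Arguments.
Unset Strict Implicit.
Unset Printing Implicit Defensive.

Import Order.TTheory GRing.Theory Num.Theory.
Local Open Scope ring_scope.

(** * Discrete logarithms in a finite field *)

Section Index.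
Variables (F : finFieldType) (g : {unit F}).
Hypothesis g_gen : generator [set: {unit F}] g.

Lemma order_gen : #[g]%g = #|F|.-1.
Proof.
by rewrite -card_finField_unit orderE; move/eqP: g_gen => <-.
Qed.

Lemma card_pred_gt0 : (0 < #|F|.-1)%N.
Proof. by rewrite -order_gen order_gt0. Qed.

Lemma gen_expr_eq (a b : nat) :
  (FinRing.uval g ^+ a == FinRing.uval g ^+ b) = (a == b %[mod #|F|.-1]).
Proof. by rewrite -!FinRing.val_unitX (inj_eq val_inj) eq_expg_mod_order order_gen. Qed.

Lemma expr_ind (x : F) : x != 0 -> FinRing.uval g ^+ ind g x = x.
Proof.
move=> x0; have xU : x \is a GRing.unit by rewrite unitfE.
have: FinRing.unit F xU \in <[g]>%g by move/eqP: g_gen => <-; rewrite inE.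
case/cyclePmin=> a; rewrite order_gen => lta /(congr1 val).
rewrite FinRing.val_unitX /= => xE.
have: x \in mkseq (fun a => FinRing.uval g ^+ a) #|F|.-1.
  by apply/mapP; exists a => //; rewrite mem_iota.
move=> xin; rewrite -[RHS](nth_index 0 xin) nth_mkseq //.
by rewrite -[X in (_ < X)%N](size_mkseq (fun a => FinRing.uval g ^+ a)) index_mem.
Qed.

Lemma ind_expr (a : nat) : ind g (FinRing.uval g ^+ a) = a %[mod #|F|.-1].
Proof.
apply/eqP; rewrite -gen_expr_eq expr_ind // expf_neq0 //.
by rewrite -unitfE; case: (g).
Qed.

Lemma indM (x y : F) : x != 0 -> y != 0 ->
  ind g (x * y) = (ind g x + ind g y)%N %[mod #|F|.-1].
Proof.
by move=> x0 y0; apply/eqP; rewrite -gen_expr_eq exprD !expr_ind // mulf_neq0.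
Qed.

Lemma ind1 : ind g 1 = 0 %[mod #|F|.-1].
Proof. by rewrite -(expr0 (FinRing.uval g)) ind_expr. Qed.

(** * Multiplicative characters and their Jacobi sums *)

Section Character.
Variable K : numFieldType.
Implicit Types (u v w : K) (x y s t : F).

(** A character of the unit group is encoded by its value [u] at [g], so that products and inverses
    of characters become those of values. It is multiplicative as soon as the order of [u] divides
    that of the group. *)
Definition mchar u x : K := if x == 0 then 0 else u ^+ ind g x.

(** The classical normalization, symmetric in [u] and [v]; the basic relations are proved for it and
    then carried over to [Jac']. *)
Definition Jac u v : K := \sum_x mchar u x * mchar v (1 - x).

(* The normalization of [jacobi]. *)
Definition Jac' u v : K := \sum_x mchar u x * mchar v (x + 1).

(* This triple sum is invariant under rotation of its arguments, and conditioning
   on x + y factors it as Jac u v * Jac (u * v) w: together these replace the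
   associativity of products of Gauss sums. *)
Definition Jac3 u v w : K :=
  \sum_x \sum_y mchar u x * mchar v y * mchar w (1 - x - y).

Local Notation N := #|F|.-1.

Lemma mchar0 u : mchar u 0 = 0.
Proof. by rewrite /mchar eqxx. Qed.

Lemma mchar_neq0 u x : x != 0 -> mchar u x = u ^+ ind g x.
Proof. by rewrite /mchar => /negPf->. Qed.

Lemma mchar_mul u v x : mchar (u * v) x = mchar u x * mchar v x.
Proof. by rewrite /mchar; case: ifP => _; rewrite ?mul0r ?exprMn. Qed.

Lemma mchar_triv x : mchar 1 x = (x != 0)%:R.
Proof. by rewrite /mchar expr1n; case: eqP. Qed.

Lemma mchar_inv u x : mchar u^-1 x = (mchar u x)^-1.
Proof. by rewrite /mchar; case: ifP => _; rewrite ?invr0 ?exprVn. Qed.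

Lemma mcharM u x y : u ^+ N = 1 -> mchar u (x * y) = mchar u x * mchar u y.
Proof.
move=> uN; rewrite /mchar mulf_eq0.
case: eqP => [|/eqP x0]; first by rewrite mul0r.
case: eqP => [|/eqP y0]; first by rewrite mulr0.
by rewrite /= -(expr_mod _ uN) indM // (expr_mod _ uN) exprD.
Qed.

Lemma mchar1 u : u ^+ N = 1 -> mchar u 1 = 1.
Proof. by move=> uN; rewrite mchar_neq0 ?oner_eq0 // -(expr_mod _ uN) ind1 mod0n. Qed.

Lemma unity_neq0 u : u ^+ N = 1 -> u != 0.
Proof.
apply: contra_eq_neq => ->.
by rewrite expr0n gtn_eqF ?card_pred_gt0 // eq_sym oner_eq0.
Qed.

Lemma mchar_unity_neq0 u x : u ^+ N = 1 -> x != 0 -> mchar u x != 0.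
Proof. by move=> uN x0; rewrite mchar_neq0 // expf_neq0 // unity_neq0. Qed.

Lemma mcharN1_sqr u : u ^+ N = 1 -> mchar u (-1) * mchar u (-1) = 1.
Proof. by move=> uN; rewrite -mcharM // mulrNN mulr1 mchar1. Qed.

Lemma mcharVN1 u : u ^+ N = 1 -> mchar u^-1 (-1) = mchar u (-1).
Proof.
move=> uN; have N10 : (-1 : F) != 0 by rewrite oppr_eq0 oner_eq0.
rewrite mchar_inv; apply: (mulfI (mchar_unity_neq0 uN N10)).
by rewrite mcharN1_sqr // mulfV // mchar_unity_neq0.
Qed.

Lemma mcharN u x : u ^+ N = 1 -> mchar u (- x) = mchar u (-1) * mchar u x.
Proof. by move=> uN; rewrite -mcharM // mulN1r. Qed.

(** Multiplying the variable by [g] multiplies the sum by [u], which is not 1. *)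
Lemma sum_mchar u : u ^+ N = 1 -> u != 1 -> \sum_x mchar u x = 0.
Proof.
move=> uN u1; have g0 : FinRing.uval g != 0 by rewrite -unitfE; case: (g).
have: mchar u (FinRing.uval g) * \sum_x mchar u x = \sum_x mchar u x.
  rewrite [RHS](reindex_inj (mulfI g0)) mulr_sumr /=.
  by apply: eq_bigr => x _; rewrite mcharM.
rewrite mchar_neq0 // -(expr_mod _ uN) -[FinRing.uval g]expr1 ind_expr.
rewrite (expr_mod _ uN) expr1 => /eqP.
rewrite -subr_eq0 -[X in _ - X]mul1r -mulrBl mulf_eq0 subr_eq0 (negPf u1).
by move/eqP.
Qed.

Lemma JacC u v : Jac u v = Jac v u.
Proof.
rewrite /Jac (reindex_inj (inv_inj (fun x : F => subKr 1 x))) /=.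
by apply: eq_bigr => x _; rewrite subKr mulrC.
Qed.

Lemma Jac'E u v : u ^+ N = 1 -> Jac' u v = mchar u (-1) * Jac u v.
Proof.
move=> uN; rewrite /Jac' /Jac (reindex_inj (@oppr_inj F)) mulr_sumr /=.
by apply: eq_bigr => x _; rewrite mcharN // mulrA [- x + 1]addrC.
Qed.

Lemma mchar_conv u v s : u ^+ N = 1 -> v ^+ N = 1 -> s != 0 ->
  \sum_x mchar u x * mchar v (s - x) = mchar (u * v) s * Jac u v.
Proof.
move=> uN vN s0; rewrite (reindex_inj (mulfI s0)) /= mulr_sumr.
apply: eq_bigr => x _; rewrite mcharM // -{2}[s]mulr1 -mulrBr mcharM //.
by rewrite mchar_mul mulrACA.
Qed.

Lemma mchar_conv0 u v : v ^+ N = 1 ->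
  \sum_x mchar u x * mchar v (0 - x) = mchar v (-1) * \sum_x mchar (u * v) x.
Proof.
move=> vN; rewrite mulr_sumr; apply: eq_bigr => x _.
by rewrite sub0r mcharN // mchar_mul mulrCA.
Qed.

Lemma Jac3_conv u v w :
  Jac3 u v w = \sum_s (\sum_x mchar u x * mchar v (s - x)) * mchar w (1 - s).
Proof.
transitivity (\sum_x \sum_s mchar u x * mchar v (s - x) * mchar w (1 - s)).
  apply: eq_bigr => x _; rewrite (reindex_inj (addIr (- x))) /=.
  by apply: eq_bigr => s _; congr (_ * mchar w _); ring.
by rewrite exchange_big; apply: eq_bigr => s _; rewrite mulr_suml.
Qed.

Lemma Jac3_rot u v w : Jac3 u v w = Jac3 v w u.
Proof.
rewrite /Jac3 exchange_big; apply: eq_bigr => y _ /=.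
rewrite (reindex_inj (inv_inj (fun x : F => subKr (1 - y) x))) /=.
apply: eq_bigr => x _; rewrite (_ : 1 - (1 - y - x) - y = x); last by ring.
by rewrite -mulrA mulrC.
Qed.

Lemma Jac3_nontriv u v w : u ^+ N = 1 -> v ^+ N = 1 -> u * v != 1 ->
  Jac3 u v w = Jac u v * Jac (u * v) w.
Proof.
move=> uN vN uv1; rewrite Jac3_conv mulr_sumr; apply: eq_bigr => s _.
(* At [s = 0] the convolution is a multiple of the sum of the nontrivial character [u * v], hence
   zero. *)
have [->|s0] := eqVneq s 0; last by rewrite mchar_conv // -mulrA mulrCA mulrA.
rewrite mchar_conv0 // sum_mchar ?mchar0 ?mulr0 ?mul0r ?mulr0 //.
by rewrite exprMn uN vN mulr1.
Qed.

Lemma sum_mchar_triv : \sum_x mchar 1 x = N%:R.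
Proof.
rewrite (eq_bigr (fun x : F => if x != 0 then 1 else 0)); last first.
  by move=> x _; rewrite mchar_triv; case: eqP.
by rewrite -big_mkcond sumr_const -(cardC1 (0 : F)).
Qed.

(** The product of two vanishing character sums, grouped by [s = x + y], receives [N * mchar u (-1)]
    from [s = 0] and [Jac u u^-1] from each of the [N] other values of [s]. *)
Lemma Jac_inv u : u ^+ N = 1 -> u != 1 -> Jac u u^-1 = - mchar u (-1).
Proof.
move=> uN u1; have u0 := unity_neq0 uN.
have vN : u^-1 ^+ N = 1 by rewrite exprVn uN invr1.
have v1 : u^-1 != 1 by rewrite invr_eq1.
have: (\sum_x mchar u x) * (\sum_x mchar u^-1 x) = 0.
  by rewrite sum_mchar // mul0r.
rewrite mulr_suml; under eq_bigr => x _.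
  rewrite mulr_sumr (reindex_inj (addIr (- x))) /=; over.
rewrite exchange_big (bigD1 (0 : F)) //= mchar_conv0 // mulfV //.
rewrite sum_mchar_triv mcharVN1 //.
under eq_bigr => s s0 do rewrite mchar_conv // mulfV // mchar_triv s0 mul1r.
rewrite sumr_const (_ : #|_| = N); last by rewrite -(cardC1 (0 : F)); apply: eq_card.
rewrite -[X in _ + X]mulr_natr -mulrDl => /eqP; rewrite mulf_eq0 pnatr_eq0.
by rewrite gtn_eqF ?card_pred_gt0 // orbF addrC addr_eq0 => /eqP.
Qed.

(** Grouping by [s = x + y], the term [s = 0] gives [N * mchar u (-1)]. The others give
    [Jac u u^-1 = - mchar u (-1)] times the sum of [mchar w (1 - s)] over [s != 0], which is -1. *)
Lemma Jac3_triv u w : u ^+ N = 1 -> u != 1 -> w ^+ N = 1 -> w != 1 ->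
  Jac3 u u^-1 w = mchar u (-1) * #|F|%:R.
Proof.
move=> uN u1 wN w1; have u0 := unity_neq0 uN.
have vN : u^-1 ^+ N = 1 by rewrite exprVn uN invr1.
rewrite Jac3_conv (bigD1 (0 : F)) //= mchar_conv0 // mulfV //.
rewrite sum_mchar_triv mcharVN1 //.
under eq_bigr => s s0 do rewrite mchar_conv // mulfV // mchar_triv s0 mul1r.
rewrite -mulr_sumr subr0 mchar1 //.
have: \sum_s mchar w (1 - s) = 0.
  by rewrite -(reindex_inj (inv_inj (fun x : F => subKr 1 x)) (P := xpredT)) /= sum_mchar.
rewrite (bigD1 (0 : F)) //= subr0 mchar1 // => /eqP; rewrite addrC addr_eq0 => /eqP->.
rewrite Jac_inv // mulrNN mulr1 mulr1 -[#|F|]prednK ?mulrS; last first.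
  exact: ltnW (finNzRing_gt1 F).
by rewrite mulrDr mulr1 addrC.
Qed.

Lemma Jac_assoc u v w : u ^+ N = 1 -> v ^+ N = 1 -> w ^+ N = 1 ->
  u * v != 1 -> v * w != 1 ->
  Jac u v * Jac (u * v) w = Jac v w * Jac (v * w) u.
Proof. by move=> uN vN wN uv vw; rewrite -!Jac3_nontriv // Jac3_rot. Qed.

(** [Jac3 u u^-1 w] is computed in two ways: directly, as a degenerate triple sum, and after a
    rotation that puts the nontrivial product [u^-1 * w] first. *)
Lemma Jac_norm u w : u ^+ N = 1 -> w ^+ N = 1 -> u != 1 -> w != 1 -> u != w ->
  Jac u^-1 w * Jac u (u^-1 * w) = mchar u (-1) * #|F|%:R.
Proof.
move=> uN wN u1 w1 uw; rewrite -(Jac3_triv uN u1 wN w1) Jac3_rot [Jac u _]JacC.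
have u0 := unity_neq0 uN.
rewrite Jac3_nontriv ?exprVn ?uN ?invr1 //.
by apply: contra uw => /eqP /(congr1 ( *%R u)); rewrite mulrA mulfV // mul1r mulr1 => ->.
Qed.

Lemma Jac'_inv u : u ^+ N = 1 -> u != 1 -> Jac' u u^-1 = -1.
Proof. by move=> uN u1; rewrite Jac'E // Jac_inv // mulrN mcharN1_sqr. Qed.

(** The substitution of [- t / (t + 1)] for [t] sends [t + 1] to its inverse. *)
Lemma Jac'_sym u v : u ^+ N = 1 -> v ^+ N = 1 ->
  Jac' u v = mchar u (-1) * Jac' u (u * v)^-1.
Proof.
(* The pole -1 is made a fixed point, so that [h] is an involution of all of [F]; both summands
   vanish there. *)
move=> uN vN; pose h (t : F) := if t == -1 then -1 else - t / (t + 1).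
have hK : involutive h.
  move=> t; rewrite {2}/h; case: (eqVneq t (-1)) => [->|t1]; first by rewrite /h eqxx.
  have t0 : t + 1 != 0 by rewrite addr_eq0.
  rewrite /h ifF; first by field; rewrite t0 addKr oner_eq0.
  apply/negbTE/negP => /eqP /(congr1 (fun a => a * (t + 1))).
  rewrite divfK // mulN1r => /oppr_inj /eqP.
  by rewrite addrC eq_sym -subr_eq0 addrK oner_eq0.
rewrite /Jac' (reindex_inj (inv_inj hK)) mulr_sumr; apply: eq_bigr => t _ /=.
rewrite /h; case: (eqVneq t (-1)) => [->|t1]; first by rewrite addNr !mchar0 !mulr0.
have t0 : t + 1 != 0 by rewrite addr_eq0.
have -> : - t / (t + 1) + 1 = (t + 1)^-1 by field.
rewrite mulNr mcharN // mcharM // -!mulrA; congr (_ * (_ * _)).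
have mV w : w ^+ N = 1 -> mchar w (t + 1)^-1 = (mchar w (t + 1))^-1.
  move=> wN; apply: (mulfI (mchar_unity_neq0 wN t0)).
  by rewrite -mcharM // !mulfV ?mchar1 // mchar_unity_neq0.
by rewrite !mV // mchar_inv mchar_mul invfM.
Qed.

(** In characteristic 2, [(g^(N/2) - 1)^2 = g^N - 1 = 0] would give [g^(N/2) = 1], against the order
    [N] of [g]. *)
Lemma two_neq0 : ~~ odd N -> (2 : F) != 0.
Proof.
move=> Nev; apply/negP => /eqP two0.
have half_lt : (N./2 < N)%N by rewrite -divn2 ltn_Pdiv ?card_pred_gt0.
have half_gt0 : (0 < N./2)%N.
  by have := card_pred_gt0; move: Nev; case: (N) => [|[|k]] //.
have: (FinRing.uval g ^+ N./2 - 1) ^+ 2 == 0.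
  rewrite sqrrB1 -exprM muln2 even_halfK //.
  have := gen_expr_eq N 0; rewrite modnn mod0n eqxx expr0 => /eqP->.
  by rewrite -mulr_natr two0 mulr0 subr0 -[1 + 1]/(2%:R : F) two0.
rewrite expf_eq0 /= subr_eq0 -[X in _ == X](expr0 (FinRing.uval g)) gen_expr_eq.
by rewrite mod0n modn_small // gtn_eqF.
Qed.

(** [mchar (-1)] is the quadratic character: the nonzero squares are the elements of even index, and
    0 has a single root. *)
Lemma card_sqr_roots t : ~~ odd N ->
  #|[pred y : F | y ^+ 2 == t]|%:R = 1 + mchar (-1) t :> K.
Proof.
move=> Nev; have m1N : (-1 : K) ^+ N = 1 by rewrite -signr_odd (negPf Nev).
have [/existsP[r /eqP rt]|nosqrt] := boolP [exists r : F, r ^+ 2 == t].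
  have [t0|t0] := eqVneq t 0.
    rewrite t0 mchar0 addr0 (eq_card (B := pred1 (0 : F))) ?card1 // => y.
    by rewrite !inE expf_eq0.
  have r0 : r != 0 by apply: contra_neq t0 => r0; rewrite -rt r0 expr0n.
  rewrite (eq_card (B := pred2 r (- r))) => [|y]; last first.
    by rewrite !inE -rt eqf_sqr.
  rewrite card2 -rt expr2 mcharM // -mchar_mul mulrNN mulr1 mchar_triv r0.
  suff -> : r != - r by [].
  by rewrite -addr_eq0 -mulr2n -mulr_natr mulf_neq0 ?two_neq0.
have t0 : t != 0.
  apply: contraNneq nosqrt => ->; apply/existsP; exists 0; by rewrite expr0n.
have todd : odd (ind g t).
  apply: contraNT nosqrt => tev; apply/existsP; exists (FinRing.uval g ^+ (ind g t)./2).
  by rewrite -exprM muln2 even_halfK // expr_ind.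
rewrite mchar_neq0 // -signr_odd todd subrr eq_card0 // => y.
by apply: contraNF nosqrt; rewrite inE => yt; apply/existsP; exists y.
Qed.

(* Complete the square in 4x(1 - x) = 1 - (2x - 1)^2. *)
Lemma Jac_dupl u : ~~ odd N -> u ^+ N = 1 -> u != 1 ->
  mchar u 4 * Jac u u = Jac u (-1).
Proof.
move=> Nev uN u1; have two0 := two_neq0 Nev.
transitivity (\sum_y mchar u (1 - y ^+ 2)).
  have inj2 : injective (fun x : F => 2 * x - 1).
    by move=> x y /addIr /(mulfI two0).
  rewrite [RHS](reindex_inj inj2) mulr_sumr; apply: eq_bigr => x _.
  by rewrite -!mcharM //; congr mchar; ring.
rewrite (partition_big (fun y => y ^+ 2) xpredT) //= JacC /Jac.
transitivity (\sum_t (1 + mchar (-1) t) * mchar u (1 - t)).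
  apply: eq_bigr => t _; rewrite -card_sqr_roots // mulr_natl -sumr_const.
  by apply: eq_bigr => y /eqP->.
under eq_bigr => t _ do rewrite mulrDl mul1r.
rewrite big_split /= [X in X + _](_ : _ = 0) ?add0r //.
by rewrite -(reindex_inj (inv_inj (fun x : F => subKr 1 x)) (P := xpredT)) /= sum_mchar.
Qed.

(** * Characters of odd order and their quadratic twists *)

Section OddOrder.
Variables (n : nat) (n_odd : odd n) (n_dvd : (2 * n %| N)%N).

Let N_even : ~~ odd N.
Proof. by case/dvdnP: n_dvd => k ->; rewrite !oddM /= andbF. Qed.

Let unityN u : u ^+ n = 1 -> u ^+ N = 1.
Proof. by case/dvdnP: n_dvd => k -> un; rewrite mulnA mulnC exprM un expr1n. Qed.

Let m1N : (-1 : K) ^+ N = 1.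
Proof. by rewrite -signr_odd (negPf N_even). Qed.

Let unityNN u : u ^+ n = 1 -> (- u) ^+ N = 1.
Proof. by move=> /unityN uN; rewrite -mulN1r exprMn uN m1N mulr1. Qed.

Lemma sqr_odd_unity u : u ^+ n = 1 -> (u ^+ 2 == 1) = (u == 1).
Proof.
move=> un; apply/eqP/eqP => [u2|->]; last by rewrite expr1n.
by rewrite -un -[n]odd_double_half n_odd -mul2n exprD exprM u2 expr1n mulr1.
Qed.

Lemma neg_odd_unity u : u ^+ n = 1 -> - u != 1.
Proof.
move=> un; apply/negP => /eqP uE; have := congr1 (fun a => a ^+ n) uE.
rewrite exprNn un mulr1 expr1n -signr_odd n_odd => /eqP.
by rewrite -subr_eq0 -opprD oppr_eq0 -[1 + 1]/(2%:R) pnatr_eq0.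
Qed.

(** The value is a sign because [(-1)^2 = 1], and also an [n]-th root of unity with [n] odd. *)
Lemma mcharN1_odd u : u ^+ n = 1 -> mchar u (-1) = 1.
Proof.
move=> un; have N10 : (-1 : F) != 0 by rewrite oppr_eq0 oner_eq0.
apply/eqP; rewrite -sqr_odd_unity; first by rewrite expr2 mcharN1_sqr // unityN.
by rewrite mchar_neq0 // -exprM mulnC exprM un expr1n.
Qed.

Lemma Jac'C u v : u ^+ n = 1 -> v ^+ n = 1 -> Jac' u v = Jac' v u.
Proof.
move=> un vn; rewrite (Jac'E _ (unityN un)) (Jac'E _ (unityN vn)).
by rewrite !mcharN1_odd // JacC.
Qed.

Lemma mcharN1_neg u : u ^+ n = 1 -> mchar (- u) (-1) = mchar (-1) (-1).
Proof. by move=> un; rewrite -[- u]mulN1r mchar_mul (mcharN1_odd un) mulr1. Qed.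

(** The norm relation for [u] and [u ^+ 2] produces [Jac u u], which the duplication formula turns
    into [Jac u (-1)]. *)
Lemma Jac_sqr_inv u : u ^+ n = 1 -> u != 1 ->
  Jac (u ^+ 2) u^-1 * Jac u (-1) = mchar u 4 * #|F|%:R.
Proof.
move=> un u1; have uN := unityN un; have u0 := unity_neq0 uN.
have u2N : (u ^+ 2) ^+ N = 1 by rewrite exprAC uN expr1n.
have u21 : u ^+ 2 != 1 by rewrite sqr_odd_unity.
have uu2 : u != u ^+ 2 by rewrite expr2 -{1}[u]mulr1 (inj_eq (mulfI u0)) eq_sym.
have := Jac_norm uN u2N u1 u21 uu2; rewrite mcharN1_odd // mul1r expr2 mulKf // => <-.
by rewrite -Jac_dupl // JacC mulrCA.
Qed.

(** [Jac u (-1)] occurs both in [Jac_sqr_inv] and in the norm relation for -1 and [- u]; comparing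
    the two eliminates it. *)
Lemma Jac'_quadratic u : u ^+ n = 1 -> u != 1 ->
  Jac' (u ^+ 2) u^-1 = mchar u 4 * Jac' (- u) (-1).
Proof.
move=> un u1; have uN := unityN un; have nu1 := neg_odd_unity un.
have m11 : (-1 : K) != 1 by apply: neg_odd_unity; rewrite expr1n.
have N1u : -1 != - u by rewrite eqr_opp eq_sym.
have u2n : (u ^+ 2) ^+ n = 1 by rewrite exprAC un expr1n.
rewrite (Jac'E _ (unityN u2n)) (Jac'E _ (unityNN un)).
rewrite mcharN1_neg // (mcharN1_odd u2n) mul1r.
have q0 : #|F|%:R != 0 :> K by rewrite pnatr_eq0 -lt0n ltnW // finNzRing_gt1.
have EA := Jac_sqr_inv un u1; have := Jac_norm m1N (unityNN un) m11 nu1 N1u.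
rewrite invrN1 mulN1r opprK [Jac (-1) u]JacC [Jac (-1) _]JacC => Enorm.
have c2 := mcharN1_sqr m1N; set c := mchar (-1) (-1) in Enorm c2 *.
apply: (mulIf q0); rewrite -[LHS]mul1r -[X in X * _ = _]c2.
transitivity (c * (Jac (u ^+ 2) u^-1 * (c * #|F|%:R))); first by ring.
rewrite -Enorm; set S := Jac (- u) (-1); set P := Jac u (-1) in EA *.
transitivity (c * S * (Jac (u ^+ 2) u^-1 * P)); first by ring.
by rewrite EA; ring.
Qed.

(** With the letters set in the proof, [A * P = a * q], [B * Q = b * q], [S * Q = c * q] and, by
    associativity, [P * J = S * C]. Multiplying [A * B * C] by [c * q] lets [P] and [Q] be absorbed,
    after which one [q] cancels. *)
Lemma Jac'_triple u v : u ^+ n = 1 -> v ^+ n = 1 -> u != 1 -> v != 1 ->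
  Jac' (u ^+ 2) u^-1 * Jac' (v ^+ 2) v^-1 * Jac' u (u * v)^-1
  = #|F|%:R * mchar u 4 * mchar v 4 * Jac' (- u) (- v).
Proof.
move=> un vn u1 v1; have uN := unityN un; have vN := unityN vn.
have nu1 := neg_odd_unity un; have nv1 := neg_odd_unity vn.
have m11 : (-1 : K) != 1 by apply: neg_odd_unity; rewrite expr1n.
have m1nv : -1 != - v by rewrite eqr_opp eq_sym.
have q0 : #|F|%:R != 0 :> K by rewrite pnatr_eq0 -lt0n ltnW // finNzRing_gt1.
have := Jac'_sym uN vN; rewrite mcharN1_odd // mul1r => <-.
have u2n : (u ^+ 2) ^+ n = 1 by rewrite exprAC un expr1n.
have v2n : (v ^+ 2) ^+ n = 1 by rewrite exprAC vn expr1n.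
rewrite (Jac'E _ (unityN u2n)) (Jac'E _ (unityN v2n)) (Jac'E _ uN) (Jac'E _ (unityNN un)).
rewrite mcharN1_neg // (mcharN1_odd un) (mcharN1_odd u2n) (mcharN1_odd v2n) !mul1r.
have EA := Jac_sqr_inv un u1; have EB := Jac_sqr_inv vn v1.
have := Jac_norm m1N (unityNN vn) m11 nv1 m1nv.
rewrite invrN1 mulN1r opprK [Jac (-1) v]JacC => Enorm.
have := Jac_assoc uN m1N (unityNN vn); rewrite mulrN1 mulN1r opprK => /(_ nu1 v1) Eass.
rewrite [Jac v u]JacC in Eass.
set c := mchar (-1) (-1) in Enorm *.
have c2 : c * c = 1 by rewrite /c mcharN1_sqr.
set A := Jac (u ^+ 2) _ in EA *; set B := Jac (v ^+ 2) _ in EB *.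
set C := Jac u v in Eass *; set J := Jac (- u) _ in Eass *.
set P := Jac u (-1) in EA Eass *; set Q := Jac v (-1) in EB Enorm *.
set S := Jac (-1) (- v) in Enorm Eass.
set a := mchar u 4 in EA *; set b := mchar v 4 in EB *.
set q := #|F|%:R in EA EB Enorm q0 *.
apply: (mulIf q0); rewrite -[LHS]mul1r -[X in X * _ = _]c2.
transitivity (c * (A * B * C * (c * q))); first by ring.
rewrite -Enorm; transitivity (c * (A * B * Q * (S * C))); first by ring.
rewrite -Eass; transitivity (c * (A * P) * (B * Q) * J); first by ring.
by rewrite EA EB; ring.
Qed.

End OddOrder.

End Character.
End Index.

(** * Power sums of the index modulo [l] *)

Section IndexModPrime.
Variables (F : finFieldType) (g : {unit F}) (l : nat).
Hypotheses (g_gen : generator [set: {unit F}] g) (l_prime : prime l).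
Hypotheses (l_gt2 : (2 < l)%N) (l2_dvd : (l ^ 2 %| #|F|.-1)%N).

Definition indFp (x : F) : 'F_l := (ind g x)%:R.

Local Notation N := #|F|.-1.

Let l_dvd : (l %| N)%N.
Proof. by apply: dvdn_trans l2_dvd; rewrite dvdn_exp. Qed.

Lemma natrFp_mod (a b : nat) : a = b %[mod N] -> a%:R = b%:R :> 'F_l.
Proof.
move=> ab; rewrite -(Fp_nat_mod l_prime a) -(Fp_nat_mod l_prime b).
by rewrite -(modn_dvdm a l_dvd) ab modn_dvdm.
Qed.

Lemma natrFp_eq0 (a : nat) : (a%:R == 0 :> 'F_l) = (l %| a)%N.
Proof. by rewrite (dvdn_pcharf (pchar_Fp l_prime)). Qed.

Lemma two_Fp_neq0 : (2 : 'F_l) != 0.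
Proof. by rewrite natrFp_eq0 gtnNdvd. Qed.

Lemma indFpM (x y : F) : x != 0 -> y != 0 -> indFp (x * y) = indFp x + indFp y.
Proof. by move=> x0 y0; rewrite /indFp -natrD; apply/natrFp_mod/indM. Qed.

Lemma indFp1 : indFp 1 = 0.
Proof. by apply: (natrFp_mod (b := 0)); apply: ind1. Qed.

(* At 0 the index takes the junk value #|F| - 1, which vanishes modulo l. *)
Lemma indFp0 : indFp 0 = 0.
Proof.
apply/eqP; rewrite natrFp_eq0 /ind memNindex ?size_mkseq //.
apply/mapP => -[a _ /esym/eqP]; rewrite expf_eq0 => /andP[_].
by apply/negP; rewrite -unitfE; case: (g).
Qed.

(** Twice this index is the index of 1, and 2 is invertible modulo [l]. *)
Lemma indFpN1 : indFp (-1) = 0.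
Proof.
have N10 : (-1 : F) != 0 by rewrite oppr_eq0 oner_eq0.
have := indFpM N10 N10; rewrite mulrNN mulr1 indFp1 -mulr2n -mulr_natr => /esym/eqP.
by rewrite mulf_eq0 (negPf two_Fp_neq0) orbF => /eqP.
Qed.

Lemma indFpV (x : F) : indFp x^-1 = - indFp x.
Proof.
have [->|x0] := eqVneq x 0; first by rewrite invr0 indFp0 oppr0.
by apply/eqP; rewrite -addr_eq0 -indFpM ?invr_eq0 // mulVf // indFp1.
Qed.

Lemma sum_indFp : \sum_x indFp x = 0.
Proof.
have E : \sum_x indFp x = - \sum_x indFp x.
  rewrite {1}(reindex_inj invr_inj) -sumrN.
  by apply: eq_bigr => x _; rewrite indFpV.
move/eqP: E; rewrite -addr_eq0 -mulr2n -mulr_natr.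
by rewrite mulf_eq0 (negPf two_Fp_neq0) orbF => /eqP.
Qed.

Lemma sum_ind (V : nmodType) (f : nat -> V) :
  \sum_(x : F | x != 0) f (ind g x) = \sum_(k < N) f k.
Proof.
pose o := Ordinal (card_pred_gt0 g_gen).
have g0 : FinRing.uval g != 0 by rewrite -unitfE; case: (g).
have ind_lt (x : F) : x != 0 -> (ind g x < N)%N.
  move=> x0; rewrite -[X in (_ < X)%N](size_mkseq (fun a => FinRing.uval g ^+ a)).
  rewrite index_mem; apply/mapP; exists (ind g x %% N)%N.
    by rewrite mem_iota /= ltn_mod (card_pred_gt0 g_gen).
  apply/eqP; rewrite -[X in X == _](expr_ind g_gen x0) gen_expr_eq //.
  by rewrite modn_mod.
rewrite (reindex (fun k : 'I_N => FinRing.uval g ^+ k)) /=.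
  apply: eq_big => [k|k _]; first by rewrite expf_neq0.
  congr f; have := ind_expr g_gen k; rewrite !modn_small //.
  by apply: ind_lt; rewrite expf_neq0.
exists (fun x => insubd o (ind g x)) => [k _|x]; last rewrite inE => x0.
  apply: val_inj; rewrite insubdK; last by apply: ind_lt; rewrite expf_neq0.
  by have := ind_expr g_gen k; rewrite !modn_small // ind_lt // expf_neq0.
rewrite (_ : nat_of_ord _ = ind g x) ?expr_ind //.
by apply: insubdK; apply: ind_lt.
Qed.

Lemma sum_periodic (V : pzRingType) (f : nat -> V) (n c : nat) :
  (forall k, f (n + k)%N = f k) ->
  \sum_(0 <= k < c * n) f k = c%:R * \sum_(0 <= k < n) f k.
Proof.
move=> fn; elim: c => [|c IHc]; first by rewrite mul0n big_geq // mul0r.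
rewrite mulSn (@big_cat_nat _ _ _ n) //= ?leq_addr //.
rewrite -{2}[n]add0n big_addn addKn mulrS mulrDl mul1r -IHc.
by congr (_ + _); apply: eq_bigr => k _; rewrite addnC fn.
Qed.

(** The exponents below [N] run through the residues modulo [l] exactly [N / l] times, and [N / l]
    is still a multiple of [l]. *)
Lemma sum_indFp_sqr : \sum_x indFp x ^+ 2 = 0.
Proof.
rewrite (bigD1 (0 : F)) //= indFp0 expr0n add0r.
rewrite (sum_ind (fun k => (k%:R : 'F_l) ^+ 2)) -(big_mkord xpredT (fun k => k%:R ^+ 2)).
have /dvdnP[c ->] := l2_dvd; rewrite mulnA sum_periodic => [|k].
  by rewrite natrM (_ : l%:R = 0) ?mulr0 ?mul0r //; apply/eqP; rewrite natrFp_eq0.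
by rewrite natrD (_ : l%:R = 0) ?add0r //; apply/eqP; rewrite natrFp_eq0.
Qed.

(* The substitution x -> 1 / x sends the sum S to the sum of squares minus S. *)
Lemma sum_indFp_mul : \sum_x indFp x * indFp (x + 1) = 0.
Proof.
set S := \sum_x _; have E : S = - S.
  transitivity (- S + \sum_x indFp x ^+ 2); last by rewrite sum_indFp_sqr addr0.
  rewrite {1}/S (reindex_inj invr_inj) /S -sumrN -big_split /=.
  apply: eq_bigr => x _ /=; rewrite indFpV.
  have [->|x0] := eqVneq x 0; first by rewrite indFp0 expr0n /=; ring.
  have [->|x1] := eqVneq x (-1); first by rewrite indFpN1 expr0n /=; ring.
  have x10 : x + 1 != 0 by rewrite addr_eq0.
  have -> : x^-1 + 1 = (x + 1) * x^-1 by field.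
  by rewrite indFpM ?invr_eq0 // indFpV; ring.
move/eqP: E; rewrite -addr_eq0 -mulr2n -mulr_natr.
by rewrite mulf_eq0 (negPf two_Fp_neq0) orbF => /eqP.
Qed.

Variable m : int.

Definition Nres (v : F) : nat := `|(Nind g m v %% l%:Z)%Z|%N.

Lemma l_neq0 : l%:Z != 0.
Proof. by rewrite gt_eqF // ltz_nat prime_gt0. Qed.

Lemma NresE (v : F) : (Nres v)%:Z = (Nind g m v %% l%:Z)%Z.
Proof. by rewrite /Nres gez0_abs // modz_ge0 // l_neq0. Qed.

Lemma Nres_lt (v : F) : (Nres v < l)%N.
Proof. by rewrite -ltz_nat NresE ltz_pmod // ltz_nat prime_gt0. Qed.

Lemma Nres_Fp (v : F) : (Nres v)%:R = indFp v + m%:~R * indFp (v + 1).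
Proof.
have -> : (Nres v)%:R = (Nind g m v)%:~R :> 'F_l.
  rewrite (divz_eq (Nind g m v) l%:Z) -NresE intrD intrM -[l%:Z%:~R]/(l%:R).
  by rewrite (_ : l%:R = 0) ?mulr0 ?add0r //; apply/eqP; rewrite natrFp_eq0.
by rewrite /Nind intrD intrM.
Qed.

(** The excluded points 0 and -1 have residue 0, because [indFp] vanishes at 0, 1 and -1. With
    [f 0 = 0] the sum thus extends to all of [F], which inversion and translation permute. *)
Lemma sum_Nres_Fp (f : nat -> nat) : f 0%N = 0%N ->
  (l %| (\sum_(v | (v != 0%R :> F) && (v != -1%R)) f (Nres v)))%N =
  (\sum_(v : F) (f (Nres v))%:R == 0 :> 'F_l).
Proof.
move=> f0; rewrite -natrFp_eq0 natr_sum; congr (_ == _).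
rewrite [RHS](bigID (fun v : F => (v != 0) && (v != -1))) /=.
rewrite [X in _ = _ + X]big1 ?addr0 // => v.
have Nres0 w : indFp w + m%:~R * indFp (w + 1) = 0 -> Nres w = 0%N.
  rewrite -Nres_Fp => /eqP; rewrite natrFp_eq0 => /dvdnP[c cE].
  by move: (Nres_lt w); rewrite cE; case: c {cE} => // c; rewrite mulSn ltnNge leq_addr.
rewrite negb_and !negbK => /orP[]/eqP->; rewrite Nres0 ?f0 //.
  by rewrite indFp0 !add0r indFp1 mulr0.
by rewrite addNr indFpN1 indFp0 mulr0 addr0.
Qed.

Lemma sum_indFp_shift : \sum_x indFp (x + 1) = 0.
Proof. by rewrite -(reindex_inj (addIr 1) (P := xpredT) (F := indFp)) /= sum_indFp. Qed.

Lemma dvdn_sum_Nres :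
  (l %| (\sum_(v | (v != 0%R :> F) && (v != -1%R)) Nres v))%N.
Proof.
rewrite (sum_Nres_Fp (f := id)) //; under eq_bigr => v _ do rewrite Nres_Fp.
by rewrite big_split /= -mulr_sumr sum_indFp sum_indFp_shift mulr0 addr0.
Qed.

(** Twice the sum is that of [Nres ^ 2 - Nres]. Writing [a] for [indFp], expanding the square leaves
    the sums of [a(v)^2], [a(v) a(v+1)] and [a(v+1)^2], which all vanish. *)
Lemma dvdn_sum_bin2_Nres :
  (l %| (\sum_(v | (v != 0%R :> F) && (v != -1%R)) 'C(Nres v, 2)))%N.
Proof.
rewrite (sum_Nres_Fp (f := fun s => 'C(s, 2))) //.
have : 2 * \sum_v ('C(Nres v, 2))%:R == 0 :> 'F_l.
  rewrite mulr_sumr; under eq_bigr => v _.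
    have -> : 2 * ('C(Nres v, 2))%:R = (Nres v)%:R ^+ 2 - (Nres v)%:R :> 'F_l.
      rewrite bin2 -natrM mul2n; case: (Nres v) => [|s]; first by rewrite expr0n subrr.
      rewrite even_halfK /=; last by rewrite oddM /= andNb.
      by rewrite natrM -[in RHS]natr1 -[X in X * _]natr1; ring.
    rewrite Nres_Fp; over.
  rewrite big_split /= sumrN [X in _ - X]big_split /= -mulr_sumr.
  rewrite sum_indFp sum_indFp_shift mulr0 addr0 subr0.
  rewrite (eq_bigr (fun v => indFp v ^+ 2 + 2 * m%:~R * (indFp v * indFp (v + 1))
    + m%:~R ^+ 2 * indFp (v + 1) ^+ 2)); last by move=> v _; ring.
  rewrite !big_split /= -!mulr_sumr sum_indFp_sqr sum_indFp_mul mulr0 !add0r.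
  rewrite -(reindex_inj (addIr 1) (P := xpredT) (F := fun x => indFp x ^+ 2)) /=.
  by rewrite sum_indFp_sqr mulr0.
by rewrite mulf_eq0 (negPf two_Fp_neq0).
Qed.

End IndexModPrime.

(** * The complex roots of unity [zeta R e] *)

Section Zeta.
Variable R : realType.

Lemma zetaX (e k : nat) : zeta R e ^+ k =
  Complex (cos (k%:R * (2 * pi / e%:R))) (sin (k%:R * (2 * pi / e%:R))).
Proof.
elim: k => [|k IHk]; first by rewrite expr0 mul0r cos0 sin0.
have -> : k.+1%:R * (2 * pi / e%:R) = 2 * pi / e%:R + k%:R * (2 * pi / e%:R) :> R.
  by rewrite -natr1 mulrDl mul1r addrC.
rewrite exprS IHk cosD sinD /zeta.
by apply/eqP; rewrite eq_complex /=; apply/andP; split; apply/eqP; ring.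
Qed.

(** By the double-angle formula [cos x = 1] would force [sin (x / 2) = 0], while [x / 2] lies
    strictly between 0 and [pi]. *)
Lemma cos_neq1 (x : R) : 0 < x < pi *+ 2 -> cos x != 1.
Proof.
move=> /andP[x0 x2]; have xE : x = (x / 2) *+ 2 by rewrite -mulr_natr divfK // pnatr_eq0.
have s0 : 0 < sin (x / 2).
  by apply: sin_gt0_pi; rewrite divr_gt0 //= ltr_pdivrMr // mulr_natr.
have cx : cos x = cos (x / 2) ^+ 2 *+ 2 - 1 by rewrite {1}xE cos_mulr2n.
have cs := cos2Dsin2 (x / 2); apply/eqP => c1.
have : sin (x / 2) ^+ 2 = 0 by lra.
by move/eqP; rewrite expf_eq0 /= gt_eqF.
Qed.

Lemma zeta_prim (e : nat) : (0 < e)%N -> e.-primitive_root (zeta R e).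
Proof.
move=> e0; have e0R : e%:R != 0 :> R by rewrite pnatr_eq0 -lt0n.
rewrite /primitive_root_of_unity e0; apply/forallP => i; rewrite unity_rootE zetaX.
have [->|ie] := eqVneq i.+1 e.
  by rewrite mulrC divfK // mulr_natl cos2pi sin2pi eqxx.
have i_lt : (i.+1 < e)%N by rewrite ltn_neqAle ie /=.
rewrite eq_complex /= (negPf (cos_neq1 _)) //.
have p0 : 0 < pi *+ 2 :> R by rewrite pmulrn_lgt0 // pi_gt0.
have e0' : 0 < e%:R :> R by rewrite ltr0n.
have -> : i.+1%:R * (2 * pi / e%:R) = (i.+1%:R / e%:R) * (pi *+ 2) :> R.
  by rewrite -mulr_natr; field.
apply/andP; split; first by rewrite mulr_gt0 // divr_gt0 // ltr0n.
rewrite -[X in _ < X]mul1r ltr_pM2r //.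
by rewrite ltr_pdivrMr // mul1r ltr_nat.
Qed.

Lemma zeta_double (e : nat) : zeta R (2 * e) ^+ 2 = zeta R e.
Proof.
rewrite zetaX /zeta natrM invfM; congr (Complex (cos _) (sin _)).
all: by move: (e%:R^-1) => t; field.
Qed.

End Zeta.

(** * Divisibility and congruences in Z[z] *)

Section Congruence.
Variables (R : realType) (z u : R[i]).
Hypothesis u_in : in_Zadj z u.

Lemma in_Zadj_int (k : int) : in_Zadj z k%:~R.
Proof. by exists k%:P; rewrite map_polyC hornerC. Qed.

Lemma in_Zadj_nat (k : nat) : in_Zadj z k%:R.
Proof. exact: in_Zadj_int k. Qed.

Lemma in_Zadj_gen : in_Zadj z z.
Proof. by exists 'X; rewrite map_polyX hornerX. Qed.

Lemma in_ZadjD a b : in_Zadj z a -> in_Zadj z b -> in_Zadj z (a + b).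
Proof. by move=> [P ->] [Q ->]; exists (P + Q); rewrite rmorphD hornerD. Qed.

Lemma in_ZadjN a : in_Zadj z a -> in_Zadj z (- a).
Proof. by move=> [P ->]; exists (- P); rewrite rmorphN hornerN. Qed.

Lemma in_ZadjB a b : in_Zadj z a -> in_Zadj z b -> in_Zadj z (a - b).
Proof. by move=> az /in_ZadjN; apply: in_ZadjD. Qed.

Lemma in_ZadjM a b : in_Zadj z a -> in_Zadj z b -> in_Zadj z (a * b).
Proof. by move=> [P ->] [Q ->]; exists (P * Q); rewrite rmorphM hornerM. Qed.

Lemma in_ZadjX a k : in_Zadj z a -> in_Zadj z (a ^+ k).
Proof.
move=> az; elim: k => [|k IHk]; first exact: (in_Zadj_int 1).
by rewrite exprS; apply: in_ZadjM.
Qed.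

Lemma in_Zadj_sum (I : Type) (r : seq I) (P : pred I) (f : I -> R[i]) :
  (forall i, P i -> in_Zadj z (f i)) -> in_Zadj z (\sum_(i <- r | P i) f i).
Proof.
move=> Pf; elim/big_rec: _ => [|i x /Pf]; first exact: (in_Zadj_int 0).
exact: in_ZadjD.
Qed.

Definition dvd_Zadj (a b : R[i]) := exists2 y, in_Zadj z y & b = a * y.

Lemma dvd_Zadj_trans a b c : dvd_Zadj a b -> dvd_Zadj b c -> dvd_Zadj a c.
Proof.
by move=> [y yz ->] [t tz ->]; exists (y * t); [apply: in_ZadjM|rewrite mulrA].
Qed.

Lemma dvd_Zadj_mulr a b c : in_Zadj z c -> dvd_Zadj a b -> dvd_Zadj a (b * c).
Proof. by move=> cz [y yz ->]; exists (y * c); [apply: in_ZadjM|rewrite mulrA]. Qed.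

Lemma dvd_Zadj_mull a b c : in_Zadj z c -> dvd_Zadj a b -> dvd_Zadj a (c * b).
Proof. by rewrite mulrC; apply: dvd_Zadj_mulr. Qed.

Lemma dvd_ZadjM a b c d : dvd_Zadj a b -> dvd_Zadj c d -> dvd_Zadj (a * c) (b * d).
Proof.
by move=> [y yz ->] [t tz ->]; exists (y * t); [apply: in_ZadjM|rewrite mulrACA].
Qed.

Lemma dvd_ZadjX a b k : dvd_Zadj a b -> dvd_Zadj (a ^+ k) (b ^+ k).
Proof. by move=> [y yz ->]; exists (y ^+ k); [apply: in_ZadjX|rewrite exprMn]. Qed.

Lemma dvd_ZadjXl a k k' : in_Zadj z a -> (k <= k')%N -> dvd_Zadj (a ^+ k) (a ^+ k').
Proof.
move=> az kk; exists (a ^+ (k' - k)); first exact: in_ZadjX.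
by rewrite -exprD subnKC.
Qed.

Lemma dvd_ZadjN a b : dvd_Zadj a b -> dvd_Zadj a (- b).
Proof. by move=> [y yz ->]; exists (- y); [apply: in_ZadjN|rewrite mulrN]. Qed.

Lemma dvd_Zadj_prod a (m n : nat) (f : nat -> R[i]) :
  (forall i, (m <= i < n)%N -> dvd_Zadj a (f i)) ->
  dvd_Zadj (a ^+ (n - m)) (\prod_(m <= i < n) f i).
Proof.
move=> af; rewrite -(prodr_const_nat (R := R[i])).
rewrite !big_nat; elim/big_rec2: _ => [|i x y /af]; last by move=> ?; apply: dvd_ZadjM.
by exists 1; [apply: (in_Zadj_int 1)|rewrite mulr1].
Qed.

Local Notation cong := (congr_Zadj z u).

Lemma congr_refl a : in_Zadj z a -> cong a a.
Proof.
move=> az; split=> //; exists 0; first exact: (in_Zadj_int 0).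
by rewrite subrr mulr0.
Qed.

Lemma congr_sym a b : cong a b -> cong b a.
Proof.
move=> [az bz [y yz E]]; split=> //; exists (- y); first exact: in_ZadjN.
by rewrite mulrN -E opprB.
Qed.

Lemma congr_trans b a c : cong a b -> cong b c -> cong a c.
Proof.
move=> [az bz [y yz E]] [_ cz [t tz E']]; split=> //.
by exists (y + t); [apply: in_ZadjD|rewrite mulrDr -E -E' addrA subrK].
Qed.

Lemma congrD a b c d : cong a b -> cong c d -> cong (a + c) (b + d).
Proof.
move=> [az bz [y yz E]] [cz dz [t tz E']]; split; try exact: in_ZadjD.
by exists (y + t); [apply: in_ZadjD|rewrite mulrDr -E -E' opprD addrACA].
Qed.

Lemma congrM a b c d : cong a b -> cong c d -> cong (a * c) (b * d).
Proof.
move=> [az bz [y yz E]] [cz dz [t tz E']]; split; try exact: in_ZadjM.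
exists (y * c + b * t); first by apply: in_ZadjD; apply: in_ZadjM.
by rewrite mulrDr mulrA -E mulrCA -E'; ring.
Qed.

Lemma congr_sum (I : Type) (r : seq I) (P : pred I) (f f' : I -> R[i]) :
  (forall i, P i -> cong (f i) (f' i)) ->
  cong (\sum_(i <- r | P i) f i) (\sum_(i <- r | P i) f' i).
Proof.
move=> ff; elim/big_rec2: _ => [|i x y /ff]; first exact: (congr_refl (in_Zadj_int 0)).
by move=> ? ?; apply: congrD.
Qed.

Lemma congr0_dvd a : dvd_Zadj u a -> cong a 0.
Proof.
move=> [y yz ->]; split; [exact: in_ZadjM|exact: (in_Zadj_int 0)|].
by exists y; rewrite ?subr0.
Qed.

End Congruence.

(** * Arithmetic modulo [(1 - z)^(l + 1)] for [z] of order [l^2] *)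

Section PrimeSquareRoot.
Variables (R : realType) (z : R[i]) (l : nat).
Hypotheses (l_prime : prime l) (l_gt2 : (2 < l)%N).
Hypothesis z_prim : (l ^ 2).-primitive_root z.

Lemma dvd_subX (a : R[i]) k : in_Zadj z a -> dvd_Zadj z (1 - a) (1 - a ^+ k).
Proof.
move=> az; exists (\sum_(i < k) a ^+ i).
  by apply: in_Zadj_sum => i _; apply: in_ZadjX.
by rewrite -[LHS]opprB subrX1 -mulNr opprB.
Qed.

Lemma prim_root_neq0 : z != 0.
Proof.
apply: contra_eq_neq (prim_expr_order z_prim) => ->.
by rewrite expr0n gtn_eqF ?expn_gt0 ?prime_gt0 // eq_sym oner_eq0.
Qed.

Lemma in_ZadjV_gen : in_Zadj z z^-1.
Proof.
have L0 : (0 < l ^ 2)%N by rewrite expn_gt0 prime_gt0.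
have z0 := prim_root_neq0.
suff -> : z^-1 = z ^+ (l ^ 2).-1 by apply: in_ZadjX; apply: in_Zadj_gen.
by apply: (mulfI z0); rewrite mulfV // -exprS prednK // prim_expr_order.
Qed.

Lemma in_Zadj_expz (k : int) : in_Zadj z (z ^ k).
Proof.
case: k => k; first by apply: in_ZadjX; apply: in_Zadj_gen.
by rewrite NegzE -exprz_inv; apply: in_ZadjX; apply: in_ZadjV_gen.
Qed.

Lemma in_Zadj_sub1 : in_Zadj z (1 - z).
Proof. by apply: in_ZadjB; [apply: (in_Zadj_int z 1)|apply: in_Zadj_gen]. Qed.

(** Evaluating [(X^n - 1) / (X - 1)] at 1 writes [n] as the product of the [1 - a^i] for
    [0 < i < n], and each factor is divisible by [1 - a]. *)
Lemma dvd_order (n : nat) (a : R[i]) : in_Zadj z a -> n.-primitive_root a ->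
  dvd_Zadj z ((1 - a) ^+ (n - 1)) n%:R.
Proof.
move=> az a_prim; have n0 := prim_order_gt0 a_prim.
suff <- : \prod_(1 <= i < n) (1 - a ^+ i) = n%:R.
  by apply: dvd_Zadj_prod => i _; apply: dvd_subX.
have := factor_Xn_sub_1 a_prim; rewrite big_ltn // expr0 subrX1 polyC1.
have X1 : 'X - 1 != 0 :> {poly R[i]} by rewrite -polyC1 polyXsubC_eq0.
move/(mulfI X1) => /(congr1 (fun p : {poly R[i]} => p.[1])).
rewrite horner_prod horner_sum; under eq_bigr => i _ do rewrite !hornerE.
move=> ->; under eq_bigr => i _ do rewrite hornerXn expr1n.
by rewrite sumr_const card_ord.
Qed.

Lemma prim_expl : l.-primitive_root (z ^+ l).
Proof.
have := dvdn_prim_root z_prim (dvdn_mulr l (dvdnn l)).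
by rewrite mulnK ?prime_gt0.
Qed.

Lemma dvd_expl : dvd_Zadj z ((1 - z) ^+ l) (1 - z ^+ l).
Proof.
have z0 := prim_root_neq0.
(* 1 - z^l = prod_i (1 - z w^i) for the l-th root of unity w = z^l. *)
suff -> : 1 - z ^+ l = \prod_(0 <= i < l) (1 - z ^+ (l * i).+1).
  rewrite -[X in _ ^+ X]subn0; apply: dvd_Zadj_prod => i _.
  exact/dvd_subX/in_Zadj_gen.
have := factor_Xn_sub_1 prim_expl => /(congr1 (fun p : {poly R[i]} => z ^+ l * p.[z^-1])).
rewrite horner_prod !hornerE mulrBr mulr1 -exprMn mulfV // expr1n => <-.
have -> : z ^+ l = \prod_(0 <= i < l) z by rewrite prodr_const_nat subn0.
rewrite -big_split /=; apply: eq_bigr => i _.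
by rewrite !hornerE mulrBr mulfV // prodr_const_nat subn0 -exprM -exprS.
Qed.

Local Notation u := ((1 - z) ^+ l.+1).
Local Notation cong := (congr_Zadj z u).

(** [(1 - z)^(l (l - 1))] divides [(1 - z^l)^(l - 1)], which divides [l] since [z^l] has order [l];
    moreover [l + 1 <= l (l - 1)] for [l >= 3]. *)
Lemma dvd_prime : dvd_Zadj z u l%:R.
Proof.
apply: dvd_Zadj_trans (dvd_order (in_ZadjX _ (in_Zadj_gen z)) prim_expl).
apply: dvd_Zadj_trans (dvd_ZadjX (l - 1) dvd_expl).
rewrite -exprM; apply: dvd_ZadjXl; first exact: in_Zadj_sub1.
by nia.
Qed.

Let u_in : in_Zadj z u.
Proof. exact/in_ZadjX/in_Zadj_sub1. Qed.

Lemma congr_nat0 (n : nat) : (l %| n)%N -> cong n%:R 0.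
Proof.
case/dvdnP=> c ->; apply: congr0_dvd => //; rewrite natrM.
by apply: dvd_Zadj_mull dvd_prime; apply: in_Zadj_nat.
Qed.

Lemma congr_nat (n m : nat) : n = m %[mod l] -> cong n%:R m%:R.
Proof.
move=> nm; have modE a : cong a%:R (a %% l)%:R.
  rewrite {1}(divn_eq a l) -[X in cong _ X]add0r natrD.
  apply: congrD; first by apply: congr_nat0; rewrite dvdn_mull.
  by apply: congr_refl; apply: in_Zadj_nat.
by apply: (congr_trans (modE n)); rewrite nm; apply/congr_sym/modE.
Qed.

Lemma congr_int (n : int) (m : nat) : (n = m%:Z %[mod l%:Z])%Z -> cong n%:~R m%:R.
Proof.
move=> nm; rewrite (divz_eq n l%:Z) nm intrD intrM.
have -> : (m%:Z %% l%:Z)%Z = (m %% l)%N by rewrite modz_nat.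
rewrite -[X in cong _ X]add0r; apply: congrD; last first.
  by rewrite -[(m %% l)%N%:~R]/((m %% l)%:R); apply: congr_nat; rewrite modn_mod.
rewrite -[l%:Z%:~R]/(l%:R); apply: congr0_dvd => //.
by apply: dvd_Zadj_mull dvd_prime; apply: in_Zadj_int.
Qed.

Variables (x : R[i]) (k : int).
Hypothesis x_def : x = z ^ k.

Let x_in : in_Zadj z x.
Proof. by rewrite x_def; apply: in_Zadj_expz. Qed.

Let x1_in : in_Zadj z (x - 1).
Proof. by apply: in_ZadjB => //; apply: (in_Zadj_int z 1). Qed.

Lemma dvd_root_sub1 : dvd_Zadj z (1 - z) (x - 1).
Proof.
rewrite x_def -[z ^ k - 1]opprB; apply: dvd_ZadjN; case: k => n.
  exact/dvd_subX/in_Zadj_gen.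
rewrite NegzE -exprz_inv; apply: dvd_Zadj_trans (dvd_subX _ in_ZadjV_gen).
exists (- z^-1); first by apply: in_ZadjN; apply: in_ZadjV_gen.
have z0 := prim_root_neq0.
by rewrite mulrN mulrBl mul1r mulfV // opprB.
Qed.

Lemma congr_exp_sub1 i : (l < i)%N -> cong ((x - 1) ^+ i) 0.
Proof.
move=> li; apply: congr0_dvd => //.
exact: dvd_Zadj_trans (dvd_ZadjXl in_Zadj_sub1 li) (dvd_ZadjX i dvd_root_sub1).
Qed.

(** The inner binomial coefficients are multiples of [l], hence congruent to 0. *)
Lemma congr_expl : cong (x ^+ l) (1 + (x - 1) ^+ l).
Proof.
have {1}-> : x = 1 + (x - 1) by rewrite addrC subrK.
rewrite [(1 + (x - 1)) ^+ l]exprDn big_ord_recr /= subnn expr0 mul1r binn mulr1n.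
apply: congrD; last by apply/congr_refl/in_ZadjX.
rewrite -(big_mkord xpredT (fun i => 1 ^+ (l - i) * (x - 1) ^+ i *+ 'C(l, i))).
rewrite big_ltn ?prime_gt0 // expr1n expr0 mulr1 bin0 mulr1n -[X in cong _ X]addr0.
apply: congrD; first by apply: congr_refl; apply: (in_Zadj_int z 1).
rewrite big_nat.
have sum0 : \sum_(1 <= i < l | (1 <= i < l)%N) (0 : R[i]) = 0 by rewrite big1.
rewrite -[X in cong _ X]sum0.
apply: congr_sum => i il; rewrite expr1n mul1r -mulr_natr.
rewrite -[X in cong _ X](mulr0 ((x - 1) ^+ i)).
apply: congrM; first exact/congr_refl/in_ZadjX.
by apply: congr_nat0; apply: prime_dvd_bin.
Qed.

(** Since [2 l > l], the square of [(x - 1)^l] vanishes, so only linear terms in it survive. *)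
Lemma congr_expl_exp n : cong (x ^+ (l * n)) (1 + n%:R * (x - 1) ^+ l).
Proof.
have one := congr_refl u (in_Zadj_int z 1).
elim: n => [|n IHn]; first by rewrite muln0 mul0r addr0.
rewrite mulnS exprD; apply: congr_trans (congrM congr_expl IHn) _.
set y := (x - 1) ^+ l.
have -> : (1 + y) * (1 + n%:R * y) = (1 + n.+1%:R * y) + n%:R * (y * y).
  by rewrite -natr1; ring.
have yz : in_Zadj z y by apply: in_ZadjX.
rewrite -[X in cong _ X]addr0; apply: congrD.
  apply: congr_refl; apply: in_ZadjD; first exact: (in_Zadj_int z 1).
  by apply: in_ZadjM => //; apply: in_Zadj_nat.
rewrite -[X in cong _ X](mulr0 n%:R); apply: congrM.
  by apply: congr_refl; apply: in_Zadj_nat.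
rewrite /y -exprD; apply: congr_exp_sub1.
by rewrite -[X in (X < _)%N]addn0 ltn_add2l prime_gt0.
Qed.

Lemma root_order : x ^+ (l ^ 2) = 1.
Proof. by rewrite x_def exprnP exprzAC -exprnP prim_expr_order // exp1rz. Qed.

Lemma congr_expz (N : int) :
  cong (x ^ N) (x ^+ `|(N %% l%:Z)%Z| + (N %/ l%:Z)%Z%:~R * (x - 1) ^+ l).
Proof.
have l0 : l%:Z != 0 by rewrite gt_eqF // ltz_nat prime_gt0.
(* The quotient [q] may be negative. Its residue [c] modulo [l] can replace it in the exponent
   because [x^(l^2) = 1], and in the coefficient because [l] is congruent to 0. *)
set q := (N %/ l%:Z)%Z; set r := `|(N %% l%:Z)%Z|%N; pose c := `|(q %% l%:Z)%Z|%N.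
have rE : (N %% l%:Z)%Z = r by rewrite gez0_abs // modz_ge0.
have cE : (q %% l%:Z)%Z = c by rewrite gez0_abs // modz_ge0.
have x0 : x != 0 by rewrite x_def expfz_neq0 // prim_root_neq0.
have -> : x ^ N = x ^+ r * x ^+ (l * c).
  rewrite (divz_eq N l%:Z) -/q rE (divz_eq q l%:Z) cE.
  rewrite mulrDl -mulrA -addrA expfzDr // mulrC.
  rewrite [X in _ * X = _](_ : _ = 1) ?mulr1.
    by rewrite addrC expfzDr // mulnC.
  by rewrite mulrC -exprz_exp -PoszM mulnn -exprnP root_order exp1rz.
set y := (x - 1) ^+ l.
have yz : in_Zadj z y by apply: in_ZadjX.
have rz : in_Zadj z (x ^+ r) by apply: in_ZadjX.
apply: (congr_trans (congrM (congr_refl _ rz) (congr_expl_exp c))); rewrite -/y.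
have -> : x ^+ r * (1 + c%:R * y) =
    (x ^+ r + c%:R * y) + c%:R * ((x ^+ r - 1) * y) by ring.
rewrite -[X in cong _ X]addr0; apply: congrD.
  apply: congrD; first exact: congr_refl.
  apply: congrM => //; last exact: congr_refl.
  by apply: congr_sym; apply: congr_int; rewrite -cE modz_mod.
(* The cross term is a multiple of [(x - 1)^(l + 1)]. *)
rewrite -[X in cong _ X](mulr0 c%:R); apply: congrM => //.
  by apply: congr_refl; apply: in_Zadj_nat.
rewrite subrX1 mulrAC -exprS -[X in cong _ X](mul0r (\sum_(i < r) x ^+ i)).
apply: congrM => //; first exact: congr_exp_sub1.
by apply: congr_refl; apply: in_Zadj_sum => i _; apply: in_ZadjX.
Qed.

End PrimeSquareRoot.

(** * Expansion of Jacobi sums of order dividing [l^2] in powers of [x - 1] *)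

Section Expansion.
Variables (R : realType) (F : finFieldType) (g : {unit F}) (z : R[i]) (l : nat).
Hypotheses (g_gen : generator [set: {unit F}] g) (l_prime : prime l).
Hypotheses (l_gt2 : (2 < l)%N) (l2_dvd : (l ^ 2 %| #|F|.-1)%N).
Hypothesis z_prim : (l ^ 2).-primitive_root z.

Local Notation u := ((1 - z) ^+ l.+1).
Local Notation cong := (congr_Zadj z u).
Local Notation good := (fun v : F => (v != 0) && (v != -1)).

Lemma in_Zadj_Jac' (a b : R[i]) :
  in_Zadj z a -> in_Zadj z b -> in_Zadj z (Jac' g a b).
Proof.
have inm c v : in_Zadj z c -> in_Zadj z (mchar g c v).
  move=> cz; rewrite /mchar; case: ifP => _; last exact: in_ZadjX.
  exact: (in_Zadj_int z 0).
by move=> az bz; apply: in_Zadj_sum => v _; apply: in_ZadjM; apply: inm.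
Qed.

Lemma sum_bin_Nres (m : int) (i : nat) :
  (\sum_(v | good v) 'C(Nres g l m v, i) =
   \sum_(i <= s < l) 'C(s, i) * bcoef g l s m)%N.
Proof.
have l0 := prime_gt0 l_prime.
transitivity (\sum_(0 <= s < l) 'C(s, i) * bcoef g l s m)%N; last first.
  have [il|li] := leqP i l.
    rewrite (@big_cat_nat _ _ _ i) //= big_nat big1 // => s /andP[_ si].
    by rewrite bin_small.
  rewrite [RHS]big_geq ?(ltnW li) // big_nat big1 // => s /andP[_ sl].
  by rewrite bin_small // (ltn_trans sl).
under [RHS]eq_big_nat => s /andP[_ sl].
  have -> : bcoef g l s m = (\sum_(v | good v) (Nres g l m v == s))%N.
    rewrite /bcoef -sum1dep_card [RHS]big_mkcond [LHS]big_mkcond /=.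
    apply: eq_bigr => v _; rewrite -(NresE g l_prime) modz_nat modn_small //.
    by rewrite eqz_nat; case: (v != 0); case: (v != -1); case: (_ == s).
  rewrite big_distrr /=; over.
rewrite exchange_big /=; apply: eq_bigr => v _.
rewrite big_mkord (bigD1 (Ordinal (Nres_lt g l_prime m v))) //= eqxx muln1.
rewrite big1 ?addn0 // => s; rewrite -val_eqE /= eq_sym => /negPf->.
by rewrite muln0.
Qed.

(** Every power in the expansion has exponent at least 3, so its term is divisible by
    [(1 - z)^(3 l)], and [3 l >= l + 1]. This disposes of the factor attached to [z ^ n] when [l]
    divides [n]. *)
Lemma congr_cexpansionN1 (b : int) (a : R[i]) :
  dvd_Zadj z ((1 - z) ^+ l) (a - 1) -> cong (cexpansion g l b a) (-1).
Proof.
move=> za; rewrite /cexpansion -[X in cong _ X]addr0.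
apply: congrD; first by apply: congr_refl; apply: (in_Zadj_int z (-1)).
have sum0 : \sum_(3 <= i < l.+1 | (3 <= i < l.+1)%N) (0 : R[i]) = 0.
  by rewrite big1.
rewrite big_nat -[X in cong _ X]sum0; apply: congr_sum => i /andP[i3 _].
rewrite -[X in cong _ X](mulr0 (ccoef g l i b)%:~R).
apply: congrM; first by apply: congr_refl; apply: in_Zadj_int.
apply: congr0_dvd; first exact/in_ZadjX/in_Zadj_sub1.
apply: dvd_Zadj_trans (dvd_ZadjX i za); rewrite -exprM.
apply: dvd_ZadjXl; first exact: in_Zadj_sub1.
apply: leq_trans (leq_mul (leqnn l) i3).
by rewrite mulnS -addn1 leq_add2l muln_gt0 prime_gt0.
Qed.

Variables (m : int) (x : R[i]) (k : int).
Hypothesis x_def : x = z ^ k.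

Let u_in : in_Zadj z u.
Proof. exact/in_ZadjX/in_Zadj_sub1. Qed.

Let x_in : in_Zadj z x.
Proof. by rewrite x_def; apply: (in_Zadj_expz l_prime z_prim). Qed.

Let x1_in : in_Zadj z (x - 1).
Proof. by apply: in_ZadjB => //; apply: (in_Zadj_int z 1). Qed.

Lemma Jac'_expz : Jac' g x (x ^ m) = \sum_(v | good v) x ^ Nind g m v.
Proof.
have x0 : x != 0 by rewrite x_def expfz_neq0 // (prim_root_neq0 l_prime z_prim).
rewrite /Jac' (bigID good) /= [X in _ + X]big1 ?addr0; last first.
  move=> v; rewrite negb_and !negbK => /orP[]/eqP->; first by rewrite mchar0 mul0r.
  by rewrite addNr mchar0 mulr0.
apply: eq_bigr => v /andP[v0 v1]; rewrite !mchar_neq0 //; last by rewrite addr_eq0.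
by rewrite /Nind expfzDr // -exprz_exp.
Qed.

(** The range goes up to [l] whatever [s] is, so that this sum can be exchanged with the sum over
    [v]. *)
Lemma exp_binomial (s : nat) : (s < l)%N ->
  x ^+ s = \sum_(0 <= i < l) 'C(s, i)%:R * (x - 1) ^+ i.
Proof.
move=> sl; have {1}-> : x = (x - 1) + 1 by rewrite subrK.
rewrite exprD1n -(big_mkord xpredT (fun i => (x - 1) ^+ i *+ 'C(s, i))).
rewrite [RHS](@big_cat_nat _ _ _ s.+1) //= [X in _ = _ + X]big_nat.
rewrite [X in _ = _ + X]big1 ?addr0; last first.
  by move=> i /andP[si _]; rewrite bin_small // mul0r.
by apply: eq_bigr => i _; rewrite mulr_natl.
Qed.

Lemma congr_Jac' : cong (Jac' g x (x ^ m)) (cexpansion g l m x).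
Proof.
have lN : (l %| #|F|.-1)%N by apply: dvdn_trans l2_dvd; rewrite dvdn_exp.
pose B i := (\sum_(v | good v) 'C(Nres g l m v, i))%N.
rewrite Jac'_expz; apply: congr_trans.
  by apply: congr_sum => v _; apply: (congr_expz l_prime l_gt2 z_prim x_def).
rewrite big_split /= -mulr_suml -rmorph_sum /= -/(Ssum g l m).
rewrite -/(\sum_(v | good v) x ^+ Nres g l m v).
have -> : \sum_(v | good v) x ^+ Nres g l m v =
    \sum_(0 <= i < l) (B i)%:R * (x - 1) ^+ i.
  under eq_bigr => v _ do rewrite exp_binomial ?(Nres_lt g l_prime) //.
  by rewrite exchange_big; apply: eq_bigr => i _; rewrite -mulr_suml natr_sum.
(* The term of degree [l] is the floor sum [Ssum], matched separately. *)
rewrite /cexpansion big_nat_recr //= /ccoef eqxx addrA.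
apply: congrD; last first.
  by apply: congr_refl; apply: in_ZadjM; [apply: in_Zadj_int|apply: in_ZadjX].
(* Degrees 3 to [l - 1] agree exactly; degrees 0, 1 and 2 remain, to be compared with -1. *)
rewrite (@big_cat_nat _ _ _ 3) //=; apply: congrD; last first.
  rewrite big_nat [X in cong _ X]big_nat.
  apply: congr_sum => i /andP[_ il]; rewrite ltn_eqF // /B sum_bin_Nres.
  rewrite -rmorph_sum; apply: congr_refl.
  by apply: in_ZadjM; [apply: in_Zadj_nat|apply: in_ZadjX].
have B0 i : (l %| B i)%N -> cong ((B i)%:R * (x - 1) ^+ i) 0.
  move=> lB; rewrite -[X in cong _ X](mul0r ((x - 1) ^+ i)).
  by apply: congrM; [apply: (congr_nat0 l_prime l_gt2 z_prim)|apply/congr_refl/in_ZadjX].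
rewrite !big_nat_recr //= big_geq // add0r expr0 mulr1.
rewrite -[X in cong _ X]addr0; apply: congrD; last exact/B0/dvdn_sum_bin2_Nres.
rewrite -[X in cong _ X]addr0; apply: congrD; last first.
  by apply: B0; rewrite /B; under eq_bigr do rewrite bin1; apply: dvdn_sum_Nres.
(* [B 0] counts the points other than 0 and -1; it is congruent to -1 because [l] divides
   [#|F| - 1]. *)
have BE : (B 0 + 2 = #|F|)%N.
  rewrite /B; under eq_bigr do rewrite bin0.
  rewrite sum1_card -[in RHS](cardC [pred v : F | good v]) /=; congr (_ + _)%N.
  rewrite (eq_card (B := pred2 (0 : F) (-1))) => [|v].
    by rewrite card2 eq_sym oppr_eq0 oner_eq0.
  by rewrite !inE negb_and !negbK.
have -> : (B 0)%:R = #|F|.-1%:R + (-1) :> R[i].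
  have F1 : (0 < #|F|)%N by apply: ltnW; apply: finNzRing_gt1.
  by rewrite -[in RHS]subn1 natrB // -BE natrD; ring.
rewrite -[X in cong _ X]add0r; apply: congrD.
  exact: (congr_nat0 l_prime l_gt2 z_prim).
exact: (congr_refl _ (in_Zadj_int z (-1))).
Qed.

End Expansion.

(** * Parity facts and assembly of the congruences *)

Lemma odd_multiple_eq (l d : nat) : odd d -> (d < 2 * l)%N -> (l %| d)%N -> d = l.
Proof.
move=> d_odd d_lt /dvdnP[[|[|c]] dE]; rewrite {}dE in d_odd d_lt *; rewrite ?mul1n //.
by move: d_lt; rewrite ltn_mul2r !ltnS ltn0 andbF.
Qed.

(** This and the next three exact halvings turn powers of [z = eta ^+ 2] into powers of [eta]. *)
Lemma half_oddN1 (n : nat) : odd n -> 2 * ((-1 - n%:Z) %/ 2)%Z = -1 - n%:Z.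
Proof. by lia. Qed.

Lemma half_odd_sub1 (n : nat) : odd n -> 2 * ((n%:Z - 1) %/ 2)%Z = n%:Z - 1.
Proof. by lia. Qed.

Lemma half_odd_add1 (n : nat) : odd n -> 2 * ((n%:Z + 1) %/ 2)%Z = n%:Z + 1.
Proof. by lia. Qed.

Lemma half_odd1 (n : nat) : odd n -> 2 * ((1 - n%:Z) %/ 2)%Z = 1 - n%:Z.
Proof. by lia. Qed.

Lemma jacobi_Jac' (R : realType) (F : finFieldType) (g : {unit F}) e (i j : int) :
  jacobi R g e i j = Jac' g (zeta R e ^ i) (zeta R e ^ j).
Proof.
apply: eq_bigr => v _; rewrite /chi /mchar.
do 2![case: ifP => _]; rewrite ?mul0r ?mulr0 //.
by congr (_ * _); rewrite !exprnP exprzAC.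
Qed.

Theorem theorem5p1 (R : realType) (F : finFieldType) (g : {unit F}) (l : nat)
    (l_prime : prime l) (l_ge3 : (3 <= l)%N)
    (q_mod : #|F| = 1 %[mod 2 * l ^ 2])
    (g_gen : generator [set: {unit F}] g) :
  let L := (l ^ 2)%N in
  let z : R[i] := zeta R L in
  let w : int := (ind g 2)%:Z in
  let J (n : nat) : R[i] := jacobi R g (2 * L) 1 n%:Z in
  let E (m : int) (x : R[i]) : R[i] := cexpansion g l m x in
  let h : int := ((L%:Z - 1) %/ 2)%Z in
  let congr (a b : R[i]) : Prop := congr_Zadj z ((1 - z) ^+ l.+1) a b in
  (forall n : nat, odd n -> (1 <= n <= 2 * L - 1)%N ->
    [/\ n = L ->
          congr (J n) (z ^ (- w) * E h z),
        forall d : nat, odd d -> (1 <= d <= 2 * l - 1)%N -> d <> l ->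
          n = (d * l)%N ->
          congr (J n)
            (- z ^ (- (w * ((d * l)%N%:Z + 1)))
             * E h z
             * E ((d * l)%N%:Z - 1) (z ^ ((-1 - (d * l)%N%:Z) %/ 2)%Z)),
        gcdn n (2 * L) = 1%N -> (1 <= n < 2 * L - 1)%N ->
          congr (J n)
            (z ^ (- (w * (n%:Z + 1)))
             * E h z
             * E h (z ^ n%:Z)
             * E (-1 - n%:Z) (z ^ ((1 - L%:Z) %/ 2)%Z))
      & n = (2 * L - 1)%N ->
          congr (J n) (-1)])
  /\
  (forall n : nat, ~~ odd n -> (2 <= n <= 2 * L - 2)%N ->
    odd (2 * L - n - 1)%N
    /\ J n = chi R g (2 * L) 1 (-1) * J (2 * L - n - 1)%N).
Proof.
move=> L z w J E h cong.
have l_gt2 : (2 < l)%N by [].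
have l_odd : odd l by case: (even_prime l_prime) l_ge3 => [->|].
have L0 : (0 < L)%N by rewrite expn_gt0 prime_gt0.
have L_odd : odd L by rewrite oddX l_odd orbT.
have LN : (2 * L %| #|F|.-1)%N.
  by rewrite -subn1 -eqn_mod_dvd ?q_mod ?eqxx // ltnW // finNzRing_gt1.
have l2N : (l ^ 2 %| #|F|.-1)%N by apply: dvdn_trans LN; rewrite dvdn_mull.
pose y := zeta R (2 * L); pose eta := - y.
have y_prim : (2 * L).-primitive_root y by apply: zeta_prim; rewrite muln_gt0.
have z_prim : (l ^ 2).-primitive_root z by apply: zeta_prim.
have eta2 : eta ^+ 2 = z by rewrite sqrrN zeta_double.
(* [y ^+ L] is a square root of 1, and it is not 1 because [y] has order [2 * L]. *)
have yL : y ^+ L = -1.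
  have : (y ^+ L) ^+ 2 == 1 by rewrite -exprM mulnC prim_expr_order.
  rewrite sqrf_eq1 -(prim_order_dvd y_prim) => /orP[/dvdn_leq|/eqP//].
  by move=> /(_ L0); rewrite leqNgt mul2n -addnn -[X in (X < _)%N]addn0 ltn_add2l L0.
have etaL : eta ^+ L = 1 by rewrite exprNn yL -signr_odd L_odd mulrNN mulr1.
have etaLz : eta ^ L%:Z = 1 by rewrite -exprnP.
have eta0 : eta != 0.
  by apply: contra_eq_neq etaL => ->; rewrite expr0n gtn_eqF // eq_sym oner_eq0.
have z_eta (a : int) : z ^ a = eta ^ (2 * a) by rewrite -eta2 exprnP exprz_exp.
have eta_mod (a b c : int) : a = b + c * L -> eta ^ a = eta ^ b.
  by move=> ->; rewrite expfzDr // [c * _]mulrC -exprz_exp etaLz exp1rz mulr1.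
(* All characters of order dividing L are powers of mchar g eta, while
   chi = mchar g (- eta). *)
have hE : 2 * h = L%:Z - 1 by apply: half_odd_sub1.
(* [eta ^+ n = 1] gives [y ^+ (2 * n) = 1], and [y] has order [2 * L]. *)
have eta_n1 n : eta ^+ n = 1 -> (L %| n)%N.
  move=> en; have: (y ^+ n) ^+ 2 == 1.
    by rewrite exprAC -sqrrN -/eta -exprM mulnC exprM en expr1n.
  by rewrite -exprM -(prim_order_dvd y_prim) mulnC dvdn_pmul2r.
have eta1 : eta != 1.
  apply/negP => /eqP eta1; have := eta_n1 1%N; rewrite expr1 eta1 => /(_ erefl).
  rewrite dvdn1 => /eqP L1; have: (l ^ 1 < l ^ 2)%N by rewrite ltn_exp2l // prime_gt1.
  by rewrite -/L L1 expn1 ltnS leqn0 => /eqP l0; move: l_gt2; rewrite l0.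
have y_odd n : odd n -> y ^+ n = - eta ^+ n.
  by move=> n_odd; rewrite /eta exprNn -signr_odd n_odd expr1 mulN1r opprK.
have JE n : J n = Jac' g y (y ^+ n) by rewrite /J jacobi_Jac' expr1z.
have z_in a : in_Zadj z (z ^ a) by apply: (in_Zadj_expz l_prime z_prim).
have L1 : (1 < L)%N by rewrite -[1%N](exp1n 2) ltn_sqr prime_gt1.
(* As [L] is odd, [eta] is a power of its own square [z]; this places [y], and the Jacobi sums
   [J n], in Z[z]. *)
have etaE : eta = z ^ ((L%:Z + 1) %/ 2)%Z.
  by rewrite z_eta -[LHS]expr1z; rewrite half_odd_add1 //; apply: (eta_mod _ _ (-1)); ring.
have eta_in : in_Zadj z eta by rewrite etaE.
have J_in n : in_Zadj z (J n).
  have y_in : in_Zadj z y by rewrite -[y]opprK; apply: in_ZadjN.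
  by rewrite JE; apply: in_Zadj_Jac' => //; apply: in_ZadjX.
have expand (m a : int) (x x' : R[i]) : x = z ^ a -> x' = x ^ m ->
    cong (Jac' g x x') (E m x).
  by move=> xE ->; exact: (congr_Jac' g_gen l_prime l_gt2 l2N z_prim m xE).
have q1 : cong #|F|%:R 1.
  apply: (congr_nat l_prime l_gt2 z_prim (m := 1)); apply/eqP.
  rewrite eqn_mod_dvd ?subn1; last by rewrite ltnW // finNzRing_gt1.
  by apply: dvdn_trans l2N; rewrite dvdn_exp.
have mchar4 u : u ^+ L = 1 -> mchar g u 4 = u ^ (2 * w).
  move=> uL; have uN : u ^+ #|F|.-1 = 1.
    by case/dvdnP: LN => k ->; rewrite mulnA mulnC exprM uL expr1n.
  have two0 : (2 : F) != 0.
    apply: (two_neq0 g_gen); case/dvdnP: LN => k ->.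
    by rewrite !oddM /= andbF.
  have -> : (4 : F) = 2 * 2 by rewrite -natrM.
  by rewrite mcharM // mchar_neq0 // -expr2 -exprM mulnC.
have A_E : cong (Jac' g (eta ^+ 2) eta^-1) (E h z).
  rewrite eta2; apply: (expand _ 1); rewrite ?expr1z // z_eta hE.
  by rewrite -exprN1; apply: (eta_mod _ _ (-1)); ring.
have unitz (a : int) : cong (z ^ a) (z ^ a) by apply: congr_refl.
have cancelz (a b : R[i]) (k : int) :
    in_Zadj z b -> cong (z ^ k * b) a -> cong b (z ^ (- k) * a).
  move=> bz kb; have z0 : z != 0 := prim_root_neq0 l_prime z_prim.
  have -> : b = z ^ (- k) * (z ^ k * b) by rewrite mulrA -expfzDr // addNr mul1r.
  exact: (congrM (unitz _) kb).
(* The triple identity at [eta] and [eta ^+ n], with [#|F|] replaced by 1 and the two character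
   values at 4 gathered into a power of [z]. *)
have triple n : odd n -> (L %| n)%N = false ->
  cong (z ^ (w * (n%:Z + 1)) * J n)
    (Jac' g (eta ^+ 2) eta^-1 * Jac' g ((eta ^+ n) ^+ 2) (eta ^+ n)^-1
      * Jac' g eta (eta * eta ^+ n)^-1).
  move=> n_odd Ln; have en1 : eta ^+ n != 1 by apply: contraFneq Ln => /eta_n1.
  have enL : (eta ^+ n) ^+ L = 1 by rewrite exprAC etaL expr1n.
  rewrite (Jac'_triple g_gen L_odd LN etaL enL eta1 en1).
  rewrite !mchar4 // -y_odd // opprK -JE -!mulrA.
  have -> : eta ^ (2 * w) * (eta ^+ n ^ (2 * w) * J n) = z ^ (w * (n%:Z + 1)) * J n.
    by rewrite exprnP exprz_exp mulrA -expfzDr // z_eta; congr (eta ^ _ * _); ring.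
  rewrite -[X in cong X _]mul1r; apply: congrM; first exact: congr_sym.
  by apply: congr_refl; apply: in_ZadjM.
have y0 : y != 0 by rewrite -oppr_eq0.
have yN : y ^+ #|F|.-1 = 1.
  by case/dvdnP: LN => k ->; rewrite mulnC exprM (prim_expr_order y_prim) expr1n.
(* This is the second argument produced by [Jac'_sym] at [y] and [y ^+ n]. For [n = 0] it gives
   [y ^+ (2 * L - 1) = y^-1], used in the last odd case. *)
have y_sub n : (n < 2 * L)%N -> y ^+ (2 * L - n - 1) = (y * y ^+ n)^-1.
  move=> nL; apply: (mulIf (x := y * y ^+ n)); first by rewrite -exprS expf_neq0.
  rewrite mulVf -?exprS ?expf_neq0 // -exprD.
  by rewrite -subnDA addn1 subnK // prim_expr_order.
have sqr_eta (n : nat) : (eta ^+ n) ^+ 2 = z ^ n by rewrite exprAC eta2.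
have inv_eta (n : nat) : (eta ^+ n)^-1 = ((eta ^+ n) ^+ 2) ^ h.
  have -> : ((eta ^+ n) ^+ 2) ^ h = eta ^ (n%:Z * (2 * h)).
    by rewrite exprnP exprnP !exprz_exp mulrA.
  by rewrite hE -exprN1 exprnP exprz_exp; apply: (eta_mod _ _ (- n%:Z)); ring.
split=> n; last first.
  move=> n_even /andP[n2 nL].
  have n_lt : (n < 2 * L)%N.
    by apply: leq_ltn_trans nL _; rewrite ltn_subrL muln_gt0 L0.
  split; first by rewrite -subnDA addn1 oddB // oddM /= n_even.
  have N10 : (-1 : F) == 0 = false by rewrite oppr_eq0 oner_eq0.
  rewrite !JE y_sub //.
  have ynN : (y ^+ n) ^+ #|F|.-1 = 1 by rewrite exprAC yN expr1n.
  rewrite (Jac'_sym g_gen yN ynN).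
  by rewrite /chi /mchar N10 expr1z.
move=> n_odd n_lt; split.
(* Here [eta ^+ n = 1], which the triple identity excludes; the quadratic relation at [eta] takes
   its place. *)
- move=> nL; rewrite JE nL yL; apply: cancelz.
    by rewrite -yL -JE.
  rewrite z_eta -mchar4 //.
  rewrite -[y]opprK -(Jac'_quadratic g_gen L_odd LN etaL eta1).
  exact: A_E.
- move=> d d_odd d_lt dl nE; rewrite -nE.
  have Ln : (L %| n)%N = false.
    rewrite nE /L expnS expn1 dvdn_pmul2r ?prime_gt0 //.
    case/andP: d_lt => _ d_lt; apply/negP => /(odd_multiple_eq d_odd) dE.
    apply: dl; apply: dE; apply: leq_ltn_trans d_lt _.
    by rewrite ltn_subrL muln_gt0 (prime_gt0 l_prime).
  have En := cancelz _ _ _ (J_in n) (triple n n_odd Ln).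
  (* [z ^ n] is a power of [z ^+ l], so [(1 - z)^l] divides [z ^ n - 1] and this factor collapses to
     -1. *)
  have B_E : cong (Jac' g ((eta ^+ n) ^+ 2) (eta ^+ n)^-1) (-1).
    apply: (congr_trans (expand h n _ _ (sqr_eta n) (inv_eta n))).
    apply: congr_cexpansionN1 => //.
    rewrite exprAC eta2 -[X in dvd_Zadj _ _ X]opprB; apply: dvd_ZadjN.
    rewrite nE mulnC exprM; apply: dvd_Zadj_trans (dvd_expl l_prime z_prim) _.
    by apply: dvd_subX; apply: in_ZadjX; apply: in_Zadj_gen.
  have C_E : cong (Jac' g eta (eta * eta ^+ n)^-1)
      (E (n%:Z - 1) (z ^ ((-1 - n%:Z) %/ 2)%Z)).
    (* The arguments are swapped in order to expand at [x = (eta * eta ^+ n)^-1]. Then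
       [eta = x ^ (n - 1)], since [- (n + 1) (n - 1) = 1 - n^2] and [n^2 = d^2 L]. *)
    rewrite (Jac'C g_gen L_odd LN etaL); last first.
      by rewrite exprVn exprMn etaL mul1r exprAC etaL expr1n invr1.
    have xE : z ^ ((-1 - n%:Z) %/ 2)%Z = (eta * eta ^+ n)^-1.
      rewrite z_eta -exprS -exprN1 exprnP exprz_exp; congr (eta ^ _).
      by rewrite half_oddN1 // intS; ring.
    rewrite -xE; apply: (expand _ ((-1 - n%:Z) %/ 2)%Z) => //.
    rewrite xE -exprS -exprN1 exprnP !exprz_exp -[LHS]expr1z nE.
    by apply: (eta_mod _ _ (d * d)%:Z); rewrite intS /L -mulnn !PoszM; ring.
  have := congr_trans En (congrM (unitz _) (congrM (congrM A_E B_E) C_E)).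
  by rewrite mulrN1 mulNr mulrN !mulNr mulrA.
- move=> n_cop n_bd.
  have Ln : (L %| n)%N = false.
    apply: contraTF L1 => Ln; rewrite -leqNgt dvdn_leq // -n_cop.
    by rewrite dvdn_gcd Ln dvdn_mull.
  have En := cancelz _ _ _ (J_in n) (triple n n_odd Ln).
  apply: (congr_trans En); rewrite -!mulrA; apply: (congrM (unitz _)).
  rewrite !mulrA; apply: (congrM (congrM A_E _)).
    by rewrite -sqr_eta; apply: (expand _ n) (sqr_eta n) (inv_eta n).
  (* Here the third factor is expanded at [eta] itself, its second argument being
     [eta ^ (-1 - n)]. *)
  have xE : z ^ ((1 - L%:Z) %/ 2)%Z = eta.
    by rewrite z_eta half_odd1 // -[RHS]expr1z; apply: (eta_mod _ _ (-1)); ring.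
  rewrite xE; apply: (expand _ ((1 - L%:Z) %/ 2)%Z) => //.
  by rewrite -exprS -exprN1 exprnP exprz_exp; congr (_ ^ _); rewrite intS; ring.
(* The two characters are inverse to each other, so the sum is exactly -1. *)
- move=> nE; have y1 : y != 1.
    apply: contra_eq_neq yL => ->.
    by rewrite expr1n -subr_eq0 opprK -[1 + 1]/(2%:R) pnatr_eq0.
  have := y_sub 0%N; rewrite muln_gt0 L0 subn0 expr0 mulr1 => /(_ erefl) yE.
  by rewrite JE nE yE (Jac'_inv g_gen yN y1); apply: congr_refl; apply: (in_Zadj_int z (-1)).
Qed.
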